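(* Let $\omega=e^{2\pi i/3}$ and $$A=\begin{pmatrix}0&0&0\\0&0&1\\0&0&0\end{pmatrix},\qquad B=\begin{pmatrix}1&0&0\\0&\omega&0\\0&0&\omega^2\end{pmatrix}.$$ Then $$\kappa_{\Omega_3}(A;B)>0=\limsup_{t\to0}\frac{l_{\Omega_3}(A,A+tB)}{|t|}.$$ Moreover, if $0\ne t_j\to0$ in $\mathbb C$ and $C_j=(c_{k,l}^j)_{k,l=1}^3$ are complex $3\times3$ matrices with $C_j\to B$ such that $\liminf_{j\to\infty}|c_{3,2}^j/t_j-3|>0$, then $$\lim_{j\to\infty}\frac{l_{\Omega_3}(A,A+t_jC_j)}{|t_j|}=0.$$
   Context: $\Omega_3\subset\mathbb C^9$ is the spectral ball: the set of complex $3\times3$ matrices all of whose eigenvalues lie in the open unit disc $\mathbb D$. For a domain $D\subset\mathbb C^N$, the Lempert function is $l_D(z,w)=\inf\{|\alpha|:\exists f\in\mathcal O(\mathbb D,D),\ f(0)=z,\ f(\alpha)=w\}$ and the Kobayashi metric is $\kappa_D(z;X)=\inf\{|\alpha|:\exists f\in\mathcal O(\mathbb D,D),\ f(0)=z,\ \alpha f'(0)=X\}$. The quotients in the limits are considered for $t$ small, respectively $j$ large, so that the matrices involved lie in $\Omega_3$. *)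

(* Defs.v *)
From mathcomp Require Import all_boot all_order all_algebra complex.
From mathcomp Require Import all_classical all_reals all_analysis.

Set Implicit Arguments.
Unset Strict Implicit.
Unset Printing Implicit Defensive.

Import Order.TTheory GRing.Theory Num.Theory.
Import numFieldNormedType.Exports.

Local Open Scope classical_set_scope.
Local Open Scope complex_scope.
Local Open Scope ring_scope.

(* Two conventions on the complex numbers R[i]:
   - the topological and normed structure is carried by the alias R[i]^o;
   - normc z : R is the modulus as a real number (whereas `|z| is its image
     in R[i]). *)
Notation normc := Normc.normc.

Section InvariantFunctions.
Variables (R : realType) (V : normedModType R[i]).

Definition unit_disc : set R[i]^o := [set z | normc z < 1].

(* O(unit_disc, D): only the values of f on the disc matter; f is arbitrary
   outside. [derivable f z 1] is complex differentiability at z, the increments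
   h in its difference quotient being complex. *)
Definition holo_disc (D : set V) (f : R[i]^o -> V) : Prop :=
  forall z, unit_disc z -> derivable f z 1 /\ D (f z).

(* Infima are taken in \bar R, so that the infimum of the empty set is +oo. *)
Definition lempert (D : set V) (z w : V) : \bar R :=
  ereal_inf [set (normc a)%:E | a in
    [set a : R[i]^o | unit_disc a /\
       exists f, [/\ holo_disc D f, f 0 = z & f a = w]]].

Definition kobayashi (D : set V) (z X : V) : \bar R :=
  ereal_inf [set (normc a)%:E | a in
    [set a : R[i]^o |
       exists f, [/\ holo_disc D f, f 0 = z & a *: derive1 f 0 = X]]].

End InvariantFunctions.

Section Matrices.
Variable R : realType.

Definition spectral_ball (n : nat) : set 'M[R[i]]_n :=
  [set M | forall a, eigenvalue M a -> normc a < 1].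

Definition cexp (z : R[i]) : R[i] :=
  (expR (complex.Re z))%:C * (cos (complex.Im z) +i* sin (complex.Im z)).

Definition omega : R[i] := cexp (2 * (pi%:C) * 'i / 3).

(* Indices in 'I_3 start at 0. *)
Definition matA : 'M[R[i]]_3 := delta_mx 1 2.

Definition matB : 'M[R[i]]_3 := diag_mx (\row_i omega ^+ i).

End Matrices.

Arguments spectral_ball R n : clear implicits.
Arguments omega R : clear implicits.
Arguments matA R : clear implicits.
Arguments matB R : clear implicits.

(* Main.v *)
Require Import Defs.
From mathcomp Require Import all_boot all_order all_algebra complex.
From mathcomp Require Import all_classical all_reals all_analysis.
From mathcomp Require Import ring lra.

(** Write sig2 M for the sum of the principal 2x2 minors of a 3x3 matrix M, so
    that tr M, sig2 M and det M are the elementary symmetric functions of its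
    eigenvalues. Indices start at 0 in the code and at 1 in the comments.

    Positivity of the Kobayashi metric. Let f be a holomorphic disc in Omega_3
    with f(0) = A and a f'(0) = B, and put s = 1/a. The functions det f and
    sig2 f are bounded on the disc, since the eigenvalues are
    ([det_bound], [sig2_bound]). As A has a single nonzero entry, at (2,3), and
    as B is diagonal with 1 + omega + omega^2 = 0, the only contribution of order
    2 to sig2 f(z) and the only unknown contribution of order 3 to det f(z) come
    from the second Taylor coefficient of the (3,2) entry of f, and they cancel
    in
        det f(z) - s z sig2 f(z) = s^3 z^3 + O(z^4)
    ([kobayashi_defect_order]). The Cauchy estimate of the third coefficient
    gives |s|^3 <= K (1 + 9 |s|), which bounds |s| and keeps |a| away from 0.

    Complex analysis. The argument needs, for functions that are only complex
    differentiable at every point, a Cauchy estimate ([cauchy_coef]) and a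
    second-order Taylor bound ([taylor2]). Goursat's bisection ([goursat]) shows
    that the integral of a function holomorphic off 0 over the boundary of the
    square [-r,r]^2 does not depend on r ([square_int_const]); comparing
    q(w) / w^(n+1) with c / w for small r gives the Cauchy estimate, for which a
    constant that is not optimal is enough. With n = 1 it bounds the derivative
    and, applied to differences of translates, makes it Lipschitz; this is the
    Taylor bound.

    Vanishing of the quotients. Let M = A + t C and alpha = e t with e > 0 fixed
    and t small. It suffices to find a disc f in Omega_3 with f(0) = A and
    f(alpha) = M. Since Omega_3 is invariant under conjugation and 1 + N with
    N^2 = 0 is joined to 1 by the polynomial family 1 + (z / alpha) N, the matrix
    M may be conjugated freely by such factors ([reach_conj]). If v = (x, 0, 1)
    is a cyclic vector of M, three of them turn M into a companion-like matrix M'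
    ([companion_conj]), for which the segment A + (z / alpha) (M' - A) has, up to
    bounded factors, the invariants
        (z / alpha) tr M,  (z / alpha) sig2 M,  (z / alpha)^2 det M
    ([companion_pencil]). They are small because tr M and sig2 M are o(t) and
    det M is o(t^2), so the segment stays in Omega_3. Finally
    det (M^2 v, M v, v) is a cubic polynomial in x with linear coefficient
    t^2 (3 - c_32 / t + o(1)) ([pencil_krylov_det], [cvg_krylov_coef1]). The
    hypothesis on c_32 / t makes this coefficient nonzero, hence one of
    x = 0, 1, 2, 3 gives a cyclic vector. The case C = B, where c_32 = 0, is the
    upper limit in the statement. *)

Set Implicit Arguments.
Unset Strict Implicit.
Unset Printing Implicit Defensive.
Import Order.TTheory GRing.Theory Num.Theory.
Import numFieldNormedType.Exports.
Local Open Scope classical_set_scope.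
Local Open Scope complex_scope.
Local Open Scope ring_scope.

(** * Moduli, topology and differentiability over the complex numbers *)
Section Basics.
Variable R : realType.
Local Notation C := R[i]^o.

Lemma normr_complexE (x : R[i]) : `|x| = (normc x)%:C.
Proof. by []. Qed.

Lemma normc_ge0 (x : R[i]) : 0 <= normc x.
Proof. by have := normr_ge0 x; rewrite normr_complexE -[0]/(0%:C) lecR. Qed.

Lemma normcB (x y : R[i]) : normc (x - y) = normc (y - x).
Proof. by rewrite -normcN opprB. Qed.

Lemma normc_real (r : R) : normc (r%:C : R[i]) = `|r|.
Proof. by rewrite /= expr0n /= addr0 sqrtr_sqr. Qed.

Lemma normc_i : normc ('i : R[i]) = 1.
Proof. by rewrite /= expr0n /= add0r expr1n sqrtr1. Qed.

Lemma normc_gt0 (w : R[i]) : (0 < normc w) = (w != 0).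
Proof. by rewrite -ltcR -normr_complexE normr_gt0. Qed.

Lemma normcX (w : R[i]) n : normc (w ^+ n) = normc w ^+ n.
Proof.
by elim: n => [|n IH]; rewrite ?expr0 ?Normc.normc1 // !exprS Normc.normcM IH.
Qed.

Lemma normc_le_ReIm (z : R[i]) : normc z <= `|complex.Re z| + `|complex.Im z|.
Proof.
case: z => x y /=; rewrite -[leRHS]ger0_norm ?addr_ge0 // -sqrtr_sqr ler_wsqrtr //.
rewrite sqrrD !real_normK ?num_real //.
by rewrite lerD2r lerDl mulrn_wge0 // mulr_ge0.
Qed.

Lemma Re_le_normc (z : R[i]) : `|complex.Re z| <= normc z.
Proof.
by case: z => x y /=; rewrite -sqrtr_sqr ler_wsqrtr // lerDl sqr_ge0.
Qed.

Lemma Im_le_normc (z : R[i]) : `|complex.Im z| <= normc z.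
Proof.
by case: z => x y /=; rewrite -sqrtr_sqr ler_wsqrtr // lerDr sqr_ge0.
Qed.

Lemma gt0_complexE (e : R[i]) : 0 < e -> e = (complex.Re e)%:C /\ 0 < complex.Re e.
Proof. by case: e => a b; rewrite ltcE /= => /andP[/eqP -> h]. Qed.

Lemma nbhs_complexP (z : C) (P : set C) :
  nbhs z P <-> exists2 d : R, 0 < d & forall w, normc (w - z) < d -> P w.
Proof.
split => [/nbhs_ballP[e /= /gt0_complexE[-> e0] H]|[d d0 H]].
  by exists (complex.Re e) => // w wz; apply: H; rewrite /ball /= distrC normr_complexE ltcR.
apply/nbhs_ballP; exists d%:C; first by rewrite /= ltcR.
by move=> w; rewrite /ball /= distrC normr_complexE ltcR => /H.
Qed.

Lemma nbhs_mxP n (M : ('M[R[i]]_n.+1 : normedModType R[i])) (P : set 'M[R[i]]_n.+1) :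
  nbhs M P <-> exists2 d : R, 0 < d &
    forall N : 'M[R[i]]_n.+1, (forall i j, normc (N i j - M i j) < d) -> P N.
Proof.
split => [/nbhs_ballP[e /= /gt0_complexE[-> e0] H]|[d d0 H]].
  exists (complex.Re e) => // N NM; apply: H; split; first by rewrite ltcR.
  by move=> i j; rewrite /ball /= distrC normr_complexE ltcR.
apply/nbhs_ballP; exists d%:C; first by rewrite /= ltcR.
move=> N [_ MN]; apply: H => i j.
by have := MN i j; rewrite /ball /= distrC normr_complexE ltcR.
Qed.

Lemma cvg_complexP T (F : set_system T) {FF : Filter F} (f : T -> C) (l : C) :
  f @ F --> l <-> forall e : R, 0 < e -> \forall x \near F, normc (f x - l) < e.
Proof.
split => [H e e0|H].
  by apply: (H [set w | normc (w - l) < e]); apply/nbhs_complexP; exists e.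
move=> P /nbhs_complexP[d d0 dP].
by near=> x; apply: dP; near: x; exact: H.
Unshelve. all: by end_near. Qed.

Lemma cvg_mxP T (F : set_system T) {FF : Filter F} n (f : T -> 'M[R[i]]_n.+1) (l : ('M[R[i]]_n.+1
    : normedModType R[i])) :
  f @ F --> l <-> forall i j, (fun x => f x i j : C) @ F --> (l i j : C).
Proof.
split => [H i j|H].
  apply/cvg_complexP => e e0.
  apply: (H [set w : 'M[R[i]]_n.+1 | normc (w i j - l i j) < e]).
  by apply/nbhs_mxP; exists e => // N; apply.
move=> P /nbhs_mxP[d d0 dP].
have H' : \forall x \near F, forall ij : 'I_n.+1 * 'I_n.+1,
    normc (f x ij.1 ij.2 - l ij.1 ij.2) < d.
  by apply: filter_forall => ij; move/cvg_complexP: (H ij.1 ij.2); exact.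
by apply: filterS H' => x Hx; apply: dP => i j; exact: (Hx (i, j)).
Qed.

Lemma derivable_mxE n (f : C -> ('M[R[i]]_n.+1 : normedModType R[i])) (z : C) :
  derivable f z 1 <-> forall i j, derivable (fun x => f x i j : C) z 1.
Proof.
split=> [/cvg_ex[l H] i j|H].
  apply/cvg_ex; exists (l i j); move/cvg_mxP: H => /(_ i j).
  by apply: cvg_trans; apply: near_eq_cvg; near=> h; rewrite !mxE.
apply/cvg_ex; exists (\matrix_(i,j) 'D_1 (fun x => f x i j : C) z).
apply/cvg_mxP => i j; rewrite mxE; have := H i j; rewrite /derivable => /cvgP.
apply: cvg_trans; apply: near_eq_cvg; near=> h; by rewrite !mxE.
Unshelve. all: by end_near. Qed.

Lemma derive1_mxE n (f : C -> ('M[R[i]]_n.+1 : normedModType R[i])) (z : C) i j :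
  derivable f z 1 -> (derive1 f z) i j = 'D_1 (fun x => f x i j : C) z.
Proof.
move=> H; rewrite derive1E.
have : (fun x : C => x^-1 *: (f (x *: 1 + z) - f z)) @ (dnbhs (0 : C)) --> 'D_1 f z by exact: H.
move=> /cvg_mxP/(_ i j) H1.
apply/esym/cvg_lim => //; apply: cvg_trans H1; apply: near_eq_cvg; near=> h; by rewrite !mxE.
Unshelve. all: by end_near. Qed.

(** Differentiability as a first-order bound valid also at zero increment, the
    only form in which it is used below. *)
Lemma derivable_epsP (h : C -> C) (z : C) : derivable h z 1 ->
  forall e : R, 0 < e -> exists2 d : R, 0 < d &
    forall w, normc w < d -> normc (h (z + w) - h z - 'D_1 h z * w) <= e * normc w.
Proof.
move=> H e e0.
have : (fun x : C => x^-1 *: (h (x *: 1 + z) - h z)) @ (dnbhs (0 : C)) --> 'D_1 h z by exact: H.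
move=> /cvg_complexP/(_ e e0); rewrite near_withinE => /nbhs_complexP[d d0 dP].
exists d => // w wd; have [->|w0] := eqVneq w 0.
  by rewrite addr0 subrr mulr0 subrr Normc.normc0 mulr0.
have := dP w; rewrite subr0 => /(_ wd w0).
have -> : (w^-1 *: (h (w *: 1 + z) - h z) - 'D_1 h z) =
   w^-1 * (h (z + w) - h z - 'D_1 h z * w).
  rewrite [w *: 1]mulr1 [w + z]addrC [RHS]mulrBr.
  by rewrite [w^-1 * ('D_1 h z * w)]mulrCA mulVf // mulr1.
rewrite Normc.normcM Normc.normcV => /ltW.
have n0 : 0 < normc w by rewrite -ltcR -normr_complexE normr_gt0.
by rewrite mulrC ler_pdivrMr.
Qed.

(** The usual rules for scalar functions written pointwise, so that differentiability of
    explicit polynomials in entries can be given as terms. *)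
Lemma derivable_mul (f g : C -> C) (z : C) : derivable f z 1 -> derivable g z 1 ->
  derivable (fun x => f x * g x) z 1.
Proof. move=> df dg; exact: (derivableM df dg). Qed.

Lemma derivable_add (f g : C -> C) (z : C) : derivable f z 1 -> derivable g z 1 ->
  derivable (fun x => f x + g x) z 1.
Proof. move=> df dg; exact: (derivableD df dg). Qed.

Lemma derivable_sub (f g : C -> C) (z : C) : derivable f z 1 -> derivable g z 1 ->
  derivable (fun x => f x - g x) z 1.
Proof. move=> df dg; exact: (derivableB df dg). Qed.

Lemma derivable_inv (f : C -> C) (z : C) : f z != 0 -> derivable f z 1 ->
  derivable (fun x => (f x)^-1) z 1.
Proof. move=> f0 df; exact: (derivableV f0 df). Qed.

Lemma derivable_const (c z : C) : derivable (fun _ : C => c) z 1.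
Proof. exact: derivable_cst. Qed.

Lemma derivable_var (z : C) : derivable (fun x : C => x) z 1.
Proof. exact: derivable_id. Qed.

Lemma derivable_monomial (c : C) n (z : C) : derivable (fun w : C => c * w ^+ n) z 1.
Proof.
elim: n => [|n IH].
  have -> : (fun w : C => c * w ^+ 0) = (fun=> c) by apply/funext => w; rewrite expr0 mulr1.
  exact: derivable_const.
have -> : (fun w : C => c * w ^+ n.+1) = (fun w : C => (c * w ^+ n) * w).
  by apply/funext => w; rewrite exprSr mulrA.
exact: (derivable_mul IH (@derivable_var z)).
Qed.

Lemma derivable_cont (h : C -> C) (z : C) : derivable h z 1 -> {for z, continuous h}.
Proof. by move/derivable1_diffP; exact: differentiable_continuous. Qed.

End Basics.

(** * Integrals of complex functions over real segments *)
Section Cint.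
Variable R : realType.
Local Notation C := R[i]^o.
Local Notation mu := (@lebesgue_measure R).
Local Notation Re := complex.Re.
Local Notation Im := complex.Im.

Definition cint (a b : R) (f : R -> C) : C :=
  (\int[mu]_(x in `[a, b]) Re (f x)) +i* (\int[mu]_(x in `[a, b]) Im (f x)).

(** Continuity at each point of the segment, from both sides even at the
    endpoints: the integrands below are restrictions of functions that are
    continuous around the segment. *)
Definition cont_on (a b : R) (f : R -> C) :=
  forall x, a <= x <= b -> {for x, continuous f}.

Lemma cont_on_Re a b f : cont_on a b f -> {within `[a, b], continuous (fun x => Re (f x))}.
Proof.
move=> H; apply: continuous_in_subspaceT => x; rewrite inE /= in_itv /= => /H Hx.
apply/cvgrPdist_lt => e e0; move/cvg_complexP: Hx => /(_ e e0).
apply: filterS => y; apply: le_lt_trans.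
by rewrite distrC -raddfB /= Re_le_normc.
Qed.

Lemma cont_on_Im a b f : cont_on a b f -> {within `[a, b], continuous (fun x => Im (f x))}.
Proof.
move=> H; apply: continuous_in_subspaceT => x; rewrite inE /= in_itv /= => /H Hx.
apply/cvgrPdist_lt => e e0; move/cvg_complexP: Hx => /(_ e e0).
apply: filterS => y; apply: le_lt_trans.
by rewrite distrC -raddfB /= Im_le_normc.
Qed.

Lemma integrable_Re a b f : cont_on a b f -> mu.-integrable `[a, b] (EFin \o (fun x => Re (f x))).
Proof.
by move=> /cont_on_Re H; apply: continuous_compact_integrable => //; exact: segment_compact.
Qed.

Lemma integrable_Im a b f : cont_on a b f -> mu.-integrable `[a, b] (EFin \o (fun x => Im (f x))).
Proof.
by move=> /cont_on_Im H; apply: continuous_compact_integrable => //; exact: segment_compact.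
Qed.

Lemma cont_onB a b f g : cont_on a b f -> cont_on a b g -> cont_on a b (fun x => f x - g x).
Proof. by move=> Hf Hg x xab; apply: (@continuousB _ C); [exact: Hf|exact: Hg]. Qed.

Lemma cont_on_cst a b k : cont_on a b (fun=> k).
Proof. by move=> x _; exact: cst_continuous. Qed.

Lemma eq_cint a b f g : (forall x, a <= x <= b -> f x = g x) -> cint a b f = cint a b g.
Proof.
move=> fg; rewrite /cint; congr (_ +i* _); apply: eq_Rintegral => x;
 by rewrite inE /= in_itv /= => /fg ->.
Qed.

Lemma cintD a b f g : cont_on a b f -> cont_on a b g ->
  cint a b (fun x => f x + g x) = cint a b f + cint a b g.
Proof.
move=> Hf Hg; rewrite /cint.
under eq_Rintegral do rewrite raddfD /=.
rewrite RintegralD //; [|exact: integrable_Re..].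
under [X in _ +i* X]eq_Rintegral do rewrite raddfD /=.
by rewrite RintegralD //; exact: integrable_Im.
Qed.

Lemma cintB a b f g : cont_on a b f -> cont_on a b g ->
  cint a b (fun x => f x - g x) = cint a b f - cint a b g.
Proof.
move=> Hf Hg; rewrite /cint.
under eq_Rintegral do rewrite raddfB /=.
rewrite RintegralB //; [|exact: integrable_Re..].
under [X in _ +i* X]eq_Rintegral do rewrite raddfB /=.
by rewrite RintegralB //; exact: integrable_Im.
Qed.

Lemma fine_mu_itv (a b : R) : a <= b -> fine (mu `[a, b]) = b - a.
Proof.
move=> ab; rewrite lebesgue_measure_itv /= lte_fin; case: ltP => //= ba.
by rewrite (@le_anti _ _ a b) ?subrr // ab ba.
Qed.

Lemma cint_cst a b k : a <= b -> cint a b (fun=> k) = (b - a)%:C * k.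
Proof.
move=> ab; rewrite /cint !Rintegral_cst // fine_mu_itv //; case: k => x y /=.
by rewrite /GRing.mul /=; congr (_ +i* _); rewrite !mul0r ?subr0 ?addr0 mulrC.
Qed.

Lemma Rintegral_split a c b (f : R -> R) : a <= c -> c <= b ->
  mu.-integrable `[a, b] (EFin \o f) ->
  \int[mu]_(x in `[a, b]) f x = \int[mu]_(x in `[a, c]) f x + \int[mu]_(x in `[c, b]) f x.
Proof.
move=> ac cb fi.
have := @Rintegral_itvB R f (BLeft a) (BRight b) c fi.
rewrite !bnd_simp => /(_ ac cb) H.
rewrite -(@Rintegral_itv_obnd_cbnd _ c (BRight b)); first by rewrite -H addrC subrK.
by apply: integrableS fi => //; apply: subset_itvr; rewrite bnd_simp.
Qed.

Lemma cint_split a c b f : a <= c -> c <= b -> cont_on a b f ->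
  cint a b f = cint a c f + cint c b f.
Proof.
by move=> ac cb H; rewrite /cint (Rintegral_split ac cb (integrable_Re H))
  (Rintegral_split ac cb (integrable_Im H)).
Qed.

Lemma Rintegral_bound a b (f : R -> R) M : a <= b -> mu.-integrable `[a, b] (EFin \o f) ->
  (forall x, a <= x <= b -> `|f x| <= M) -> `|\int[mu]_(x in `[a, b]) f x| <= M * (b - a).
Proof.
move=> ab fi fM; apply: le_trans (le_normr_Rintegral _ fi) _ => //.
rewrite -(fine_mu_itv ab) -Rintegral_cst //; apply: le_Rintegral => //.
- exact: (integrable_norm fi).
- exact: (integrable_Re (@cont_on_cst a b M%:C)).
Qed.

(** The factor 2 comes from treating real and imaginary parts separately; no
    estimate below needs the sharp constant. *)
Lemma cint_bound a b f M : a <= b -> cont_on a b f ->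
  (forall x, a <= x <= b -> normc (f x) <= M) -> normc (cint a b f) <= 2 * M * (b - a).
Proof.
move=> ab fc fM; apply: le_trans (normc_le_ReIm _) _; rewrite /cint /=.
rewrite -mulrA mulr_natl mulr2n lerD //; apply: Rintegral_bound => //.
- exact: integrable_Re.
- by move=> x /fM; apply: le_trans; exact: Re_le_normc.
- exact: integrable_Im.
- by move=> x /fM; apply: le_trans; exact: Im_le_normc.
Qed.

Lemma cint_near_cst a b f k M : a <= b -> cont_on a b f ->
  (forall x, a <= x <= b -> normc (f x - k) <= M) ->
  normc (cint a b f - (b - a)%:C * k) <= 2 * M * (b - a).
Proof.
move=> ab fc fM; have kc := @cont_on_cst a b k.
by have := cint_bound ab (cont_onB fc kc) fM; rewrite (cintB fc kc) (cint_cst k ab).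
Qed.

Lemma Im_cint_ge a b f m : a <= b -> cont_on a b f ->
  (forall x, a <= x <= b -> m <= Im (f x)) -> m * (b - a) <= Im (cint a b f).
Proof.
move=> ab fc fM; rewrite /cint /= -(fine_mu_itv ab) -Rintegral_cst //.
apply: le_Rintegral => //.
- exact: (integrable_Re (@cont_on_cst a b m%:C)).
- exact: integrable_Im.
Qed.

End Cint.

(** * Bisection of rectangles *)
Section Bisection.
Variables (R : realType) (p q x0 y0 : R) (P : R -> R -> R -> Prop).
Hypotheses (p0 : 0 <= p) (q0 : 0 <= q).

(** The rectangles of the subdivision are homothetic to the initial one: the one
    with corner (x, y) and scale l is [x, x + l p] x [y, y + l q]. *)
Definition subrect (x y l : R) :=
  [/\ 0 < l, x0 <= x, x + l * p <= x0 + p, y0 <= y & y + l * q <= y0 + q].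

Hypothesis split : forall x y l, subrect x y l ->
  P x y (l / 2) -> P (x + l / 2 * p) y (l / 2) ->
  P x (y + l / 2 * q) (l / 2) -> P (x + l / 2 * p) (y + l / 2 * q) (l / 2) -> P x y l.
Hypothesis local : forall xs ys, x0 <= xs <= x0 + p -> y0 <= ys <= y0 + q ->
  exists2 r, 0 < r & forall x y l, subrect x y l -> l < r ->
    x <= xs <= x + l * p -> y <= ys <= y + l * q -> P x y l.

Lemma bad_child x y l : subrect x y l -> ~ P x y l -> exists xy : R * R,
  [/\ ~ P xy.1 xy.2 (l / 2), x <= xy.1, xy.1 + l / 2 * p <= x + l * p,
      y <= xy.2 & xy.2 + l / 2 * q <= y + l * q].
Proof.
move=> [l0 xx0 xp yy0 yq] nP; apply: contrapT => nex; apply: nP.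
have l20 : 0 <= l / 2 by lra.
have lp : 0 <= l / 2 * p by rewrite mulr_ge0.
have lq : 0 <= l / 2 * q by rewrite mulr_ge0.
have lpE : l * p = l / 2 * p + l / 2 * p by lra.
have lqE : l * q = l / 2 * q + l / 2 * q by lra.
by apply: split => //; apply: contrapT => nP; apply: nex;
  [exists (x, y)|exists (x + l / 2 * p, y)|
   exists (x, y + l / 2 * q)|exists (x + l / 2 * p, y + l / 2 * q)];
  split => //=; lra.
Qed.

(** A property of rectangles that passes from the four quarters to the whole, and
    that holds for all small rectangles around any given point, holds for the
    initial rectangle. Otherwise repeated bisection gives nested bad rectangles, and
    small ones among them contain their common point. *)
Lemma bisection : P x0 y0 1.
Proof.
apply: contrapT => nP.
have [f fP] : exists f : nat -> R * R, f 0%N = (x0, y0) /\ forall n,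
    let l := (2 ^+ n)^-1 in
    [/\ ~ P (f n).1 (f n).2 l /\ subrect (f n).1 (f n).2 l,
       (f n).1 <= (f n.+1).1, (f n.+1).1 + l / 2 * p <= (f n).1 + l * p,
       (f n).2 <= (f n.+1).2 & (f n.+1).2 + l / 2 * q <= (f n).2 + l * q].
  pose step (n : nat) (xy xy' : R * R) := let l : R := (2 ^+ n)^-1 in
     subrect xy.1 xy.2 l -> ~ P xy.1 xy.2 l ->
    [/\ ~ P xy'.1 xy'.2 (l / 2), xy.1 <= xy'.1, xy'.1 + l / 2 * p <= xy.1 + l * p,
      xy.2 <= xy'.2 & xy'.2 + l / 2 * q <= xy.2 + l * q].
  have /choice[g gP] : forall nxy : nat * (R * R), exists xy', step nxy.1 nxy.2 xy'.
    move=> [n [x y]]; rewrite /step /=.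
    have [iq|] := pselect (subrect x y (2 ^+ n)^-1); last by exists (0, 0).
    have [?|np] := pselect (P x y (2 ^+ n)^-1); first by exists (0, 0).
    by have [xy' ?] := bad_child iq np; exists xy'.
  pose f := fix f n := if n is m.+1 then g (m, f m) else (x0, y0).
  exists f; split => //.
  have good n : subrect (f n).1 (f n).2 (2 ^+ n)^-1 /\ ~ P (f n).1 (f n).2 (2 ^+ n)^-1.
    elim: n => [|n [IH1 IH2]].
      by rewrite /= expr0 invr1; split => //; split => //=; rewrite ?mul1r // ltr01.
    have := gP (n, f n) IH1 IH2.
    rewrite -/(f n.+1) /= -/(f n.+1) => -[h1 h2 h3 h4 h5].
    have -> : (2 ^+ n.+1)^-1 = (2 ^+ n)^-1 / 2 :> R by rewrite exprS invfM mulrC.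
    case: IH1 => l0 xx0 xp yy0 yq; split => //; split; lra.
  move=> n l; have [g1 g2] := good n.
  by have [h1 h2 h3 h4 h5] := gP (n, f n) g1 g2.
case: fP => _ fP.
pose l n : R := (2 ^+ n)^-1.
have lS n : l n.+1 = l n / 2 by rewrite /l exprS invfM mulrC.
(* Corners increase and opposite corners decrease, so the supremum of the
    corners lies in all the intervals. *)
have mono (u : nat -> R) (r : R) : (forall n, u n <= u n.+1) ->
    (forall n, u n.+1 + l n / 2 * r <= u n + l n * r) -> 0 <= r ->
    exists s, forall n, u n <= s <= u n + l n * r.
  move=> uS vS r0.
  have um n k : u n <= u (n + k)%N.
    by elim: k => [|k IH]; rewrite ?addn0 // addnS (le_trans IH).
  have vm n k : u (n + k)%N + l (n + k)%N * r <= u n + l n * r.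
    by elim: k => [|k IH]; rewrite ?addn0 // addnS lS (le_trans (vS _)).
  have lr0 n : 0 <= l n * r by rewrite mulr_ge0 // /l invr_ge0 exprn_ge0.
  have ub n : ubound (range u) (u n + l n * r).
    move=> _ [m _ <-]; have := um m n; have := vm n m; rewrite addnC => h1 h2.
    by have := lr0 (m + n)%N; lra.
  exists (sup (range u)) => n; apply/andP; split.
    apply: ub_le_sup; [by exists (u 0%N + l 0%N * r)|by exists n].
  apply: ge_sup; [by exists (u 0%N), 0%N|exact: ub].
have [|||xs xsP] := mono (fun n => (f n).1) p; rewrite // ?/l.
  1,2: by move=> n; case: (fP n).
have [|||ys ysP] := mono (fun n => (f n).2) q; rewrite // ?/l.
  1,2: by move=> n; case: (fP n).
have xsQ : x0 <= xs <= x0 + p.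
  by have [[_ [_ h1 h2 _ _]] _ _ _ _] := fP 0%N; have /andP[h3 h4] := xsP 0%N; exact/andP/(conj
      (le_trans h1 h3) (le_trans h4 h2)).
have ysQ : y0 <= ys <= y0 + q.
  by have [[_ [_ _ _ h1 h2]] _ _ _ _] := fP 0%N; have /andP[h3 h4] := ysP 0%N; exact/andP/(conj
      (le_trans h1 h3) (le_trans h4 h2)).
have [r r0 rP] := local xsQ ysQ.
have [n _ /(_ n (leqnn n)) nr] := near_infty_natSinv_expn_lt (PosNum r0).
have [[nPn iq] _ _ _ _] := fP n; apply: nPn; apply: (rP _ _ _ iq); [|exact: (xsP n)|exact: (ysP n)].
by move: nr; rewrite /= div1r.
Qed.

End Bisection.

(** * Integrals over boundaries of rectangles and Goursat's theorem *)
Section Goursat.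
Variable R : realType.
Local Notation C := R[i]^o.
Implicit Types (h : C -> C) (a b c d x y : R).

(** The integral of h over the boundary of [a, b] x [c, d]. Opposite sides are
    combined under the integral sign, so that an affine h has constant integrands
    and its contributions cancel without computing any integral. *)
Definition rect_int h a b c d : C :=
  cint a b (fun x => h (x +i* c) - h (x +i* d)) +
  'i * cint c d (fun y => h (b +i* y) - h (a +i* y)).

Definition hcont h y a b := cont_on a b (fun x => h (x +i* y)).
Definition vcont h x c d := cont_on c d (fun y => h (x +i* y)).

Lemma derivable_hcont h y a b :
  (forall x, a <= x <= b -> derivable h (x +i* y : C) 1) -> hcont h y a b.
Proof.
move=> H x /H /derivable_cont /cvg_complexP Hc; apply/cvg_complexP => e /Hc.
move=> /nbhs_complexP[r r0 rP]; apply/nbhs_ballP; exists r => //= z.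
rewrite /ball /= => zx; apply: rP; rewrite distrC in zx.
by rewrite /= subrr expr0n /= addr0 sqrtr_sqr.
Qed.

Lemma derivable_vcont h x c d :
  (forall y, c <= y <= d -> derivable h (x +i* y : C) 1) -> vcont h x c d.
Proof.
move=> H y /H /derivable_cont /cvg_complexP Hc; apply/cvg_complexP => e /Hc.
move=> /nbhs_complexP[r r0 rP]; apply/nbhs_ballP; exists r => //= z.
rewrite /ball /= => zx; apply: rP; rewrite distrC in zx.
by rewrite /= subrr expr0n /= add0r sqrtr_sqr.
Qed.

Lemma rect_int_splitx h a m b c d : a <= m -> m <= b ->
  hcont h c a b -> hcont h d a b -> vcont h a c d -> vcont h m c d -> vcont h b c d ->
  rect_int h a b c d = rect_int h a m c d + rect_int h m b c d.
Proof.
move=> am mb hc hd va vm vb; rewrite /rect_int (cint_split am mb (cont_onB hc hd)).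
have -> : cint c d (fun y => h (b +i* y) - h (a +i* y)) =
    cint c d (fun y => h (b +i* y) - h (m +i* y)) + cint c d (fun y => h (m +i* y) - h (a +i* y)).
  rewrite -(cintD (cont_onB vb vm) (cont_onB vm va)); apply: eq_cint => y _.
  by rewrite addrA subrK.
rewrite mulrDr; ring.
Qed.

Lemma rect_int_splity h a b c m d : c <= m -> m <= d ->
  vcont h a c d -> vcont h b c d -> hcont h c a b -> hcont h m a b -> hcont h d a b ->
  rect_int h a b c d = rect_int h a b c m + rect_int h a b m d.
Proof.
move=> cm md va vb hc hm hd; rewrite /rect_int (cint_split cm md (cont_onB vb va)).
have -> : cint a b (fun x => h (x +i* c) - h (x +i* d)) =
    cint a b (fun x => h (x +i* c) - h (x +i* m)) + cint a b (fun x => h (x +i* m) - h (x +i* d)).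
  rewrite -(cintD (cont_onB hc hm) (cont_onB hm hd)); apply: eq_cint => y _.
  by rewrite addrA subrK.
rewrite mulrDr; ring.
Qed.

Lemma rect_int_split4 h a m b c n d : a <= m -> m <= b -> c <= n -> n <= d ->
  (forall x y, a <= x <= b -> c <= y <= d -> derivable h (x +i* y : C) 1) ->
  rect_int h a b c d = (rect_int h a m c n + rect_int h a m n d) + (rect_int h m b c n + rect_int
      h m b n d).
Proof.
move=> am mb cn nd H.
have hor a' b' y : a <= a' -> b' <= b -> c <= y <= d -> hcont h y a' b'.
  move=> aa bb yP; apply: derivable_hcont => x /andP[h1 h2].
  by apply: H => //; rewrite (le_trans aa h1) (le_trans h2 bb).
have ver x c' d' : a <= x <= b -> c <= c' -> d' <= d -> vcont h x c' d'.
  move=> xP cc dd; apply: derivable_vcont => y /andP[h1 h2].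
  by apply: H => //; rewrite (le_trans cc h1) (le_trans h2 dd).
have ab := le_trans am mb; have cd := le_trans cn nd.
have aP : a <= a <= b by rewrite lexx ab.
have mP : a <= m <= b by rewrite am mb.
have bP : a <= b <= b by rewrite lexx ab.
have cP : c <= c <= d by rewrite lexx cd.
have nP : c <= n <= d by rewrite cn nd.
have dP : c <= d <= d by rewrite lexx cd.
rewrite (rect_int_splitx am mb (hor _ _ _ (lexx a) (lexx b) cP) (hor _ _ _ (lexx a) (lexx b) dP)
  (ver _ _ _ aP (lexx c) (lexx d)) (ver _ _ _ mP (lexx c) (lexx d)) (ver _ _ _ bP (lexx c) (lexx
      d))).
rewrite (rect_int_splity cn nd (ver _ _ _ aP (lexx c) (lexx d)) (ver _ _ _ mP (lexx c) (lexx d))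
  (hor _ _ _ (lexx a) mb cP) (hor _ _ _ (lexx a) mb nP) (hor _ _ _ (lexx a) mb dP)).
by rewrite (rect_int_splity cn nd (ver _ _ _ mP (lexx c) (lexx d)) (ver _ _ _ bP (lexx c) (lexx d))
  (hor _ _ _ am (lexx b) cP) (hor _ _ _ am (lexx b) nP) (hor _ _ _ am (lexx b) dP)).
Qed.

(** If h differs little from an affine map of slope D across the rectangle, the
    contributions of the affine part to the two pairs of sides cancel, and only the
    errors remain. *)
Lemma rect_int_affine_bound h a b c d D M : a <= b -> c <= d ->
  hcont h c a b -> hcont h d a b -> vcont h a c d -> vcont h b c d ->
  (forall x, a <= x <= b -> normc (h (x +i* c) - h (x +i* d) - D * (0 +i* (c - d))) <= M) ->
  (forall y, c <= y <= d -> normc (h (b +i* y) - h (a +i* y) - D * ((b - a) +i* 0)) <= M) ->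
  normc (rect_int h a b c d) <= 2 * M * ((b - a) + (d - c)).
Proof.
move=> ab cd hc hd va vb M1 M2.
have B1 := cint_near_cst ab (cont_onB hc hd) M1.
have B2 := cint_near_cst cd (cont_onB vb va) M2.
have -> : rect_int h a b c d =
   (cint a b (fun x => h (x +i* c) - h (x +i* d)) - (b - a)%:C * (D * (0 +i* (c - d)))) +
   'i * (cint c d (fun y => h (b +i* y) - h (a +i* y)) - (d - c)%:C * (D * ((b - a) +i* 0))).
  rewrite /rect_int; set I1 := cint _ _ _; set I2 := cint _ _ _.
  have -> : 0 +i* (c - d) = 'i * - (d - c)%:C :> C.
    by apply/eqP; rewrite eq_complex /=; apply/andP; split; apply/eqP; ring.
  have -> : (b - a) +i* 0 = (b - a)%:C by [].
  ring.
rewrite [leRHS]mulrDr; apply: le_trans (le_normcD _ _) _; apply: lerD => //.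
by rewrite Normc.normcM normc_i mul1r.
Qed.

(** Small rectangles around a point where h is differentiable have an integral of
    size at most e times the square of their scale, a bound that adds up exactly
    over quarters, so [bisection] applies. *)
Theorem goursat h a b c d : a <= b -> c <= d ->
  (forall x y, a <= x <= b -> c <= y <= d -> derivable h (x +i* y : C) 1) ->
  rect_int h a b c d = 0.
Proof.
move=> ab cd H; set p := b - a; set q := d - c.
have p0 : 0 <= p by rewrite subr_ge0.
have q0 : 0 <= q by rewrite subr_ge0.
suff small e : 0 < e -> normc (rect_int h a b c d) <= e.
  apply: Normc.eq0_normc; apply/eqP; rewrite eq_le normc_ge0 andbT.
  by apply/ler_addgt0Pr => e e0; rewrite add0r; exact: small.
move=> e0.
pose P x y l := normc (rect_int h x (x + l * p) y (y + l * q)) <= e * l ^+ 2.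
suff : P a c 1 by rewrite /P !mul1r expr1n mulr1 /p /q !(addrC _ (_ - _)) !subrK.
have Hsub x y l : subrect p q a c x y l -> forall x' y', x <= x' <= x + l * p ->
    y <= y' <= y + l * q -> derivable h (x' +i* y' : C) 1.
  move=> [l0 h1 h2 h3 h4] x' y' /andP[h5 h6] /andP[h7 h8].
  by apply: H; apply/andP; split; rewrite /p /q in h2 h4 h6 h8 *; lra.
have lp l : 0 < l -> 0 <= l * p by move=> l0; rewrite mulr_ge0 // ltW.
have lq l : 0 < l -> 0 <= l * q by move=> l0; rewrite mulr_ge0 // ltW.
apply: (@bisection R p q a c P p0 q0).
- move=> x y l iq; have l0 : 0 < l by case: iq.
  have l20 : 0 < l / 2 by lra.
  have lp2 := lp _ l20; have lq2 := lq _ l20.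
  have HH := Hsub _ _ _ iq.
  have lpE : l * p = l / 2 * p + l / 2 * p by lra.
  have lqE : l * q = l / 2 * q + l / 2 * q by lra.
  have xm : x <= x + l / 2 * p by lra.
  have xM : x + l / 2 * p <= x + l * p by lra.
  have ym : y <= y + l / 2 * q by lra.
  have yM : y + l / 2 * q <= y + l * q by lra.
  have Q1 : x + l / 2 * p + l / 2 * p = x + l * p by lra.
  have Q2 : y + l / 2 * q + l / 2 * q = y + l * q by lra.
  rewrite /P Q1 Q2 => P1 P2 P3 P4.
  rewrite (rect_int_split4 xm xM ym yM HH).
  have -> : e * l ^+ 2 = (e * (l / 2) ^+ 2 + e * (l / 2) ^+ 2) +
     (e * (l / 2) ^+ 2 + e * (l / 2) ^+ 2) by field.
  exact: le_trans (le_normcD _ _) (lerD (le_trans (le_normcD _ _) (lerD P1 P3))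
    (le_trans (le_normcD _ _) (lerD P2 P4))).
move=> xs ys xsP ysP.
have Dh : derivable h (xs +i* ys : C) 1.
  by apply: H; rewrite /p /q in xsP ysP; lra.
set s := p + q + 1; have s0 : 0 < s by rewrite /s; lra.
have [|r r0 rP] := derivable_epsP Dh (e := e / (4 * s ^+ 2)).
  by rewrite divr_gt0 // mulr_gt0 // exprn_gt0.
(* The increments between points of the rectangle and the centre are at
    most l s, and two such increments enter each integrand. *)
exists (r / s); first by rewrite divr_gt0.
move=> x y l iq; rewrite ltr_pdivlMr // => lr xsx ysy; have l0 : 0 < l by case: iq.
have HH := Hsub _ _ _ iq.
set D := 'D_1 h _ in rP; set e' := e / _ in rP.
have e'0 : 0 <= e' by rewrite /e' divr_ge0 // ?ltW // mulr_gt0 // exprn_gt0.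
have key u v : x <= u <= x + l * p -> y <= v <= y + l * q ->
   normc (h (u +i* v) - h (xs +i* ys) - D * ((u - xs) +i* (v - ys))) <= e' * (l * s).
  move=> uP vP.
  have wb : normc ((u - xs) +i* (v - ys) : R[i]) <= l * s.
    apply: le_trans (normc_le_ReIm _) _ => /=.
    have h1 : `|u - xs| <= l * p by rewrite ler_norml; lra.
    have h2 : `|v - ys| <= l * q by rewrite ler_norml; lra.
    by rewrite /s; lra.
  have := rP ((u - xs) +i* (v - ys)) (le_lt_trans wb lr).
  have -> : (xs +i* ys : C) + ((u - xs) +i* (v - ys)) = u +i* v.
    by rewrite /GRing.add /=; congr (_ +i* _); rewrite addrC subrK.
  by move/le_trans; apply; rewrite ler_wpM2l.
have lp0 := lp _ l0; have lq0 := lq _ l0.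
have X1 : x <= x <= x + l * p by lra.
have X2 : x <= x + l * p <= x + l * p by lra.
have Y1 : y <= y <= y + l * q by lra.
have Y2 : y <= y + l * q <= y + l * q by lra.
have key2 u v u' v' : x <= u <= x + l * p -> y <= v <= y + l * q ->
   x <= u' <= x + l * p -> y <= v' <= y + l * q ->
   normc (h (u +i* v) - h (u' +i* v') - D * ((u - u') +i* (v - v'))) <= 2 * (e' * (l * s)).
  move=> u1 v1 u2 v2.
  have -> : h (u +i* v) - h (u' +i* v') - D * ((u - u') +i* (v - v')) =
     (h (u +i* v) - h (xs +i* ys) - D * ((u - xs) +i* (v - ys))) -
     (h (u' +i* v') - h (xs +i* ys) - D * ((u' - xs) +i* (v' - ys))).
    have -> : (u - u') +i* (v - v') = ((u - xs) +i* (v - ys)) - ((u' - xs) +i* (v' - ys)) :> C.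
      by apply/eqP; rewrite eq_complex /=; apply/andP; split; apply/eqP; ring.
    ring.
  rewrite mulr_natl mulr2n; apply: le_trans (le_normcD _ _) _; rewrite normcN.
  by apply: lerD; exact: key.
have xlp : x <= x + l * p by lra.
have ylq : y <= y + l * q by lra.
apply: le_trans (@rect_int_affine_bound h x (x + l * p) y (y + l * q) D (2 * (e' * (l * s))) xlp
    ylq _ _ _ _ _ _) _.
- by apply: derivable_hcont => x' x'P; exact: HH.
- by apply: derivable_hcont => x' x'P; exact: HH.
- by apply: derivable_vcont => x' x'P; exact: HH.
- by apply: derivable_vcont => x' x'P; exact: HH.
- by move=> u uP; rewrite -(subrr u); exact: key2.
- by move=> u uP; rewrite -(subrr u); exact: key2.
have -> : e * l ^+ 2 = 2 * (2 * (e' * (l * s))) * (l * s).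
  by rewrite /e'; field; rewrite gt_eqF.
rewrite ler_wpM2l //; last by rewrite /s; lra.
have ls0 : 0 <= l * s by apply: mulr_ge0; exact: ltW.
by apply: mulr_ge0 => //; apply: mulr_ge0 => //; exact: mulr_ge0.
Qed.

End Goursat.

(** * Integrals over squares around a puncture *)
Section Coef.
Variable R : realType.
Local Notation C := R[i]^o.
Implicit Types (h q : C -> C) (r : R).

Lemma Re_cint_ge a b (f : R -> C) m : a <= b -> cont_on a b f ->
  (forall x, a <= x <= b -> m <= complex.Re (f x)) -> m * (b - a) <= complex.Re (cint a b f).
Proof.
move=> ab fc fM; rewrite /cint /= -(fine_mu_itv ab) -Rintegral_cst //.
apply: le_Rintegral => //.
- exact: (integrable_Re (@cont_on_cst R a b m%:C)).
- exact: integrable_Re.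
Qed.

Definition square_int h r := rect_int h (- r) r (- r) r.

Definition holo_punctured rho h := forall w : C, w != 0 -> normc w < rho -> derivable h w 1.

Lemma complex_pt_neq0 (x y : R) : (x != 0) || (y != 0) -> (x +i* y : C) != 0.
Proof. by rewrite eq_complex negb_and. Qed.

Lemma complex_pt_le (x y r : R) : `|x| <= r -> `|y| <= r -> normc (x +i* y) <= 2 * r.
Proof.
move=> h1 h2; apply: le_trans (normc_le_ReIm _) _ => /=.
by rewrite mulr_natl mulr2n lerD.
Qed.

Lemma holo_punctured_derivable rho h r x y : holo_punctured rho h -> 2 * r < rho ->
  (x != 0) || (y != 0) -> - r <= x <= r -> - r <= y <= r -> derivable h (x +i* y : C) 1.
Proof.
move=> H rr xy xr yr; apply: H; first exact: complex_pt_neq0.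
by apply: le_lt_trans rr; apply: complex_pt_le; rewrite ler_norml.
Qed.

Lemma holo_punctured_hcont rho h r a b y : holo_punctured rho h -> 2 * r < rho ->
  y != 0 -> - r <= y <= r -> - r <= a -> b <= r -> hcont h y a b.
Proof.
move=> H rr y0 yr ar br; apply: derivable_hcont => x /andP[h1 h2].
apply: (holo_punctured_derivable H rr) => //; first by rewrite y0 orbT.
by rewrite (le_trans ar h1) (le_trans h2 br).
Qed.

Lemma holo_punctured_vcont rho h r c d x : holo_punctured rho h -> 2 * r < rho ->
  x != 0 -> - r <= x <= r -> - r <= c -> d <= r -> vcont h x c d.
Proof.
move=> H rr x0 xr cr dr; apply: derivable_vcont => y /andP[h1 h2].
apply: (holo_punctured_derivable H rr) => //; first by rewrite x0.
by rewrite (le_trans cr h1) (le_trans h2 dr).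
Qed.

(** The region between the two squares splits into rectangles avoiding 0, on
    which Goursat's theorem applies: a left and a right strip of full height, and a
    bottom and a top rectangle between them. *)
Lemma square_int_const rho h r r' : holo_punctured rho h -> 0 < r -> r <= r' -> 2 * r' < rho ->
  square_int h r' = square_int h r.
Proof.
move=> H r0 rr' r'rho.
have r'0 : 0 < r' by exact: lt_le_trans rr'.
have h1 : - r' <= - r by rewrite lerN2.
have h2 : - r <= r by lra.
have h3 : - r' <= r by lra.
have h4 : - r <= r' by lra.
have h5 : - r' <= r' by lra.
have n1 : r != 0 by rewrite gt_eqF.
have n2 : r' != 0 by rewrite gt_eqF.
have n3 : - r != 0 by rewrite oppr_eq0.
have n4 : - r' != 0 by rewrite oppr_eq0.
have b1 : - r' <= - r' <= r' by rewrite lexx h5.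
have b2 : - r' <= - r <= r' by rewrite h1 h4.
have b3 : - r' <= r <= r' by rewrite h3 rr'.
have b4 : - r' <= r' <= r' by rewrite h5 lexx.
have l1 := lexx r'; have l2 := lexx (- r').
have hor a b y : y != 0 -> - r' <= y <= r' -> - r' <= a -> b <= r' -> hcont h y a b.
  exact: (holo_punctured_hcont H r'rho).
have ver c d x : x != 0 -> - r' <= x <= r' -> - r' <= c -> d <= r' -> vcont h x c d.
  exact: (holo_punctured_vcont H r'rho).
have dr x y := @holo_punctured_derivable rho h r' x y H r'rho.
rewrite /square_int.
rewrite (rect_int_splitx h1 h4 (hor _ _ _ n4 b1 l2 l1) (hor _ _ _ n2 b4 l2 l1)
  (ver _ _ _ n4 b1 l2 l1) (ver _ _ _ n3 b2 l2 l1) (ver _ _ _ n2 b4 l2 l1)).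
rewrite (rect_int_splitx h2 rr' (hor _ _ _ n4 b1 h1 l1) (hor _ _ _ n2 b4 h1 l1)
  (ver _ _ _ n3 b2 l2 l1) (ver _ _ _ n1 b3 l2 l1) (ver _ _ _ n2 b4 l2 l1)).
rewrite (rect_int_splity h1 h4 (ver _ _ _ n3 b2 l2 l1) (ver _ _ _ n1 b3 l2 l1)
  (hor _ _ _ n4 b1 h1 rr') (hor _ _ _ n3 b2 h1 rr') (hor _ _ _ n2 b4 h1 rr')).
rewrite (rect_int_splity h2 rr' (ver _ _ _ n3 b2 h1 l1) (ver _ _ _ n1 b3 h1 l1)
  (hor _ _ _ n3 b2 h1 rr') (hor _ _ _ n1 b3 h1 rr') (hor _ _ _ n2 b4 h1 rr')).
have rpos x : r <= x -> x != 0 by move=> rx; rewrite gt_eqF // (lt_le_trans r0 rx).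
have rneg x : x <= - r -> x != 0.
  by move=> rx; rewrite lt_eqF // (le_lt_trans rx) // oppr_lt0.
rewrite !(goursat (h := h) (a := - r') (b := - r)) //; last first.
  move=> x y /andP[x1 x2] yP; apply: dr => //; first by rewrite rneg.
  by rewrite x1 (le_trans x2 h4).
rewrite !(goursat (h := h) (a := r) (b := r')) //; last first.
  move=> x y /andP[x1 x2] yP; apply: dr => //; first by rewrite rpos.
  by rewrite x2 (le_trans h3 x1).
rewrite (goursat (h := h) (a := - r) (b := r) (c := - r') (d := - r)) //; last first.
  move=> x y /andP[x1 x2] /andP[y1 y2]; apply: dr => //; first by rewrite (rneg y) ?orbT.
    by rewrite (le_trans h1 x1) (le_trans x2 rr').
  by rewrite y1 (le_trans y2 h4).
rewrite (goursat (h := h) (a := - r) (b := r) (c := r) (d := r')) //; last first.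
  move=> x y /andP[x1 x2] /andP[y1 y2]; apply: dr => //; first by rewrite (rpos y) ?orbT.
    by rewrite (le_trans h1 x1) (le_trans x2 rr').
  by rewrite y2 (le_trans h3 y1).
by rewrite !add0r !addr0.
Qed.

Lemma rect_intB h g a b c d :
  hcont h c a b -> hcont h d a b -> vcont h a c d -> vcont h b c d ->
  hcont g c a b -> hcont g d a b -> vcont g a c d -> vcont g b c d ->
  rect_int (fun w => h w - g w) a b c d = rect_int h a b c d - rect_int g a b c d.
Proof.
move=> h1 h2 h3 h4 g1 g2 g3 g4; rewrite /rect_int.
have -> : cint a b (fun x => h (x +i* c) - g (x +i* c) - (h (x +i* d) - g (x +i* d))) =
   cint a b (fun x => h (x +i* c) - h (x +i* d)) - cint a b (fun x => g (x +i* c) - g (x +i* d)).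
  rewrite -(cintB (cont_onB h1 h2) (cont_onB g1 g2)); apply: eq_cint => x _; ring.
have -> : cint c d (fun y => h (b +i* y) - g (b +i* y) - (h (a +i* y) - g (a +i* y))) =
   cint c d (fun y => h (b +i* y) - h (a +i* y)) - cint c d (fun y => g (b +i* y) - g (a +i* y)).
  rewrite -(cintB (cont_onB h4 h3) (cont_onB g4 g3)); apply: eq_cint => x _; ring.
ring.
Qed.

Lemma square_intB rho h g r : holo_punctured rho h -> holo_punctured rho g -> 0 < r -> 2 * r <
    rho ->
  square_int (fun w => h w - g w) r = square_int h r - square_int g r.
Proof.
move=> H G r0 rr.
have n1 : r != 0 by rewrite gt_eqF.
have n2 : - r != 0 by rewrite oppr_eq0.
have h1 : - r <= r by lra.
have b1 : - r <= r <= r by rewrite lexx h1.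
have b2 : - r <= - r <= r by rewrite lexx h1.
have hor k a b y := @holo_punctured_hcont rho k r a b y.
have ver k a b y := @holo_punctured_vcont rho k r a b y.
by apply: rect_intB; (apply: hor || apply: ver).
Qed.

(** The points of the boundary of the square have modulus between r and 2 r, and
    its length is 8 r. *)
Lemma square_int_bound rho h r M : holo_punctured rho h -> 0 < r -> 2 * r < rho ->
  (forall w, r <= normc w <= 2 * r -> normc (h w) <= M) -> normc (square_int h r) <= 16 * M * r.
Proof.
move=> H r0 rr hM.
have n1 : r != 0 by rewrite gt_eqF.
have n2 : - r != 0 by rewrite oppr_eq0.
have h1 : - r <= r by lra.
have b1 : - r <= r <= r by rewrite lexx h1.
have b2 : - r <= - r <= r by rewrite lexx h1.
have hor k a b y := @holo_punctured_hcont rho k r a b y.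
have ver k a b y := @holo_punctured_vcont rho k r a b y.
have -> : 16 * M * r = 2 * (2 * M) * ((r - - r) + (r - - r)) by ring.
have key x y : - r <= x <= r -> - r <= y <= r -> (`|x| = r) \/ (`|y| = r) ->
    normc (h (x +i* y)) <= M.
  move=> xr yr E; apply: hM; apply/andP; split; last by apply: complex_pt_le; rewrite ler_norml.
  by case: E => <-; [exact: (Re_le_normc (x +i* y))|exact: (Im_le_normc (x +i* y))].
have nr : `|r| = r by rewrite gtr0_norm.
have nr' : `|- r| = r by rewrite normrN.
have two (u v : C) : normc u <= M -> normc v <= M -> normc (u - v) <= 2 * M.
  by move=> uM vM; rewrite mulr_natl mulr2n (le_trans (le_normcD _ _)) // normcN lerD.
apply: (@rect_int_affine_bound R h (- r) r (- r) r 0) => //; try by (apply: hor || apply: ver).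
- by move=> x xr; rewrite mul0r subr0; apply: two; apply: key => //; right.
- by move=> x xr; rewrite mul0r subr0; apply: two; apply: key => //; left.
Qed.

Lemma holo_punctured_inv rho : holo_punctured rho (fun w : C => w^-1).
Proof. by move=> w w0 _; apply: (@derivableV _ C (fun w : C => w)) => //; exact: derivable_id. Qed.

Lemma invcE (x y : R) : (x +i* y)^-1 = (x / (x ^+ 2 + y ^+ 2)) -i* (y / (x ^+ 2 + y ^+ 2)).
Proof. by []. Qed.

(** This integral is 2 pi i, but a lower bound of its modulus is enough: on the
    horizontal sides the imaginary part of 1 / (x - i r) - 1 / (x + i r) is
    2 r / (x^2 + r^2) >= 1 / r, and the vertical sides contribute a nonnegative
    imaginary part. *)
Lemma square_int_inv r : 0 < r -> 2 <= normc (square_int (fun w : C => w^-1) r).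
Proof.
move=> r0; apply: le_trans (Im_le_normc _); apply: le_trans (ler_norm _).
have n1 : r != 0 by rewrite gt_eqF.
have n2 : - r != 0 by rewrite oppr_eq0.
have h1 : - r <= r by lra.
have b1 : - r <= r <= r by rewrite lexx h1.
have b2 : - r <= - r <= r by rewrite lexx h1.
have rr : 2 * r < 4 * r by lra.
have hor := holo_punctured_hcont (@holo_punctured_inv (4 * r)) rr.
have ver := holo_punctured_vcont (@holo_punctured_inv (4 * r)) rr.
rewrite /square_int /rect_int.
set I1 := cint _ _ _; set I2 := cint _ _ _.
have -> : complex.Im (I1 + 'i * I2) = complex.Im I1 + complex.Re I2.
  by case: I1 => u v; case: I2 => u' v' /=; rewrite mul0r mul1r add0r.
have pos x : - r <= x <= r -> 0 < x ^+ 2 + r ^+ 2.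
  by move=> _; rewrite addrC ltr_wpDr ?sqr_ge0 // exprn_gt0.
have est x : - r <= x <= r -> r^-1 <= 2 * r / (x ^+ 2 + r ^+ 2).
  move=> xr; have p := pos _ xr; rewrite ler_pdivlMr // mulrC ler_pdivrMr //.
  have : x ^+ 2 <= r ^+ 2 by rewrite -subr_ge0 subr_sqr mulr_ge0 //; lra.
  by move=> ?; rewrite -mulrA -expr2; lra.
have e1 : 2 <= complex.Im I1.
  have -> : 2 = r^-1 * (r - - r) by field.
  apply: Im_cint_ge => //; first by apply: cont_onB; apply: hor.
  move=> x xr; apply: le_trans (est _ xr) _; rewrite raddfB !invcE /= sqrrN.
  by rewrite -subr_ge0 le_eqVlt; apply/orP; left; apply/eqP; ring.
suff e2 : 0 <= complex.Re I2 by lra.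
have -> : 0 = 0 * (r - - r) by rewrite mul0r.
apply: Re_cint_ge => //; first by apply: cont_onB; apply: ver.
move=> x xr; rewrite raddfB !invcE /= sqrrN mulNr opprK addr_ge0 // divr_ge0 ?ltW //.
all: by rewrite addrC ?pos.
Qed.

End Coef.

(** * Cauchy estimates *)
Section Cauchy.
Variable R : realType.
Local Notation C := R[i]^o.
Implicit Types (h q b : C -> C) (r rho : R).

(** Here c is the n-th Taylor coefficient of q, given by an expansion at 0. With
    h(w) = q(w) / (c w^(n+1)), the function h(w) - 1 / w is o(1 / w), so its integral
    over small squares tends to 0; being independent of the square, it vanishes.
    Hence h and 1 / w have the same integral over a fixed square, where h is at most
    of order M / |c|. *)
Lemma cauchy_coef n rho : 0 < rho -> exists2 K : R, 0 < K &
  forall q (c : C) M,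
    (forall w, normc w < rho -> derivable q w 1) ->
    (forall w, normc w < rho -> normc (q w) <= M) ->
    (forall e, 0 < e -> exists2 d, 0 < d &
       forall w, normc w < d -> normc (q w - c * w ^+ n) <= e * normc w ^+ n) ->
    normc c <= K * M.
Proof.
move=> rho0; pose r' := rho / 4.
have r'0 : 0 < r' by rewrite divr_gt0.
have r'rho : 2 * r' < rho by rewrite /r'; lra.
exists (8 / r' ^+ n); first by rewrite divr_gt0 // exprn_gt0.
move=> q c M dq qM qc.
have M0 : 0 <= M by apply: le_trans (qM 0 _); rewrite ?Normc.normc0 ?normc_ge0.
have K0 : 0 <= 8 / r' ^+ n * M by rewrite mulr_ge0 // divr_ge0 // exprn_ge0 // ltW.
have [->|c0] := eqVneq c 0; first by rewrite Normc.normc0.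
have nc : 0 < normc c by rewrite normc_gt0.
pose h (w : C) : C := q w * (c * w ^+ n.+1)^-1.
pose i0 (w : C) : C := w^-1.
have Xn0 (w : C) m : w != 0 -> c * w ^+ m != 0 by move=> w0; rewrite mulf_neq0 // expf_neq0.
have dh : holo_punctured rho h.
  move=> w w0 wr; apply: (derivable_mul (dq _ wr)).
  exact: (@derivable_inv R (fun w : C => c * w ^+ n.+1) w (Xn0 w n.+1 w0) (@derivable_monomial R
      c n.+1 w)).
have di : holo_punctured rho i0 := holo_punctured_inv (rho := rho).
have dk : holo_punctured rho (fun w => h w - i0 w).
  by move=> w w0 wr; exact: derivable_sub (dh w w0 wr) (di w w0 wr).
(* The integral is computed on a square of radius r <= d / 4, inside the
    disc of radius d where the expansion is within e of its leading term. *)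
have k0 : square_int (fun w => h w - i0 w) r' = 0.
  apply: Normc.eq0_normc; apply/eqP; rewrite eq_le normc_ge0 andbT.
  apply/ler_addgt0Pr => e e0; rewrite add0r.
  have [|d d0 dP] := qc (e * normc c / 16); first by rewrite divr_gt0 // mulr_gt0.
  pose r := Num.min r' (d / 4).
  have r0 : 0 < r by rewrite lt_min r'0 divr_gt0.
  have rr' : r <= r' by rewrite ge_min lexx.
  have rd : 2 * r < d.
    have : r <= d / 4 by rewrite ge_min lexx orbT.
    by move=> ?; lra.
  rewrite (square_int_const dk r0 rr' r'rho).
  have r2 : 2 * r < rho by lra.
  have -> : e = 16 * (e / 16 / r) * r by field; rewrite gt_eqF.
  apply: (square_int_bound dk r0 r2) => w /andP[rw wr].
  have w0 : w != 0 by rewrite -normc_gt0 (lt_le_trans r0).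
  have -> : h w - i0 w = (q w - c * w ^+ n) * (c * w ^+ n.+1)^-1.
    rewrite /h /i0 mulrBl; congr (_ - _).
    by rewrite exprSr mulrA invfM mulrA divff ?mul1r // Xn0.
  rewrite Normc.normcM Normc.normcV Normc.normcM normcX ler_pdivrMr; last first.
    by rewrite mulr_gt0 // exprn_gt0 // normc_gt0.
  apply: le_trans (dP w (le_lt_trans wr rd)) _.
  have -> : e / 16 / r * (normc c * normc w ^+ n.+1) =
     (normc w / r) * (e * normc c / 16 * normc w ^+ n).
    by rewrite exprS; field; rewrite gt_eqF.
  rewrite ler_peMl //; first by rewrite mulr_ge0 ?exprn_ge0 ?normc_ge0 // ltW // divr_gt0 //
      mulr_gt0.
  by rewrite ler_pdivlMr // mul1r.
have : normc (square_int i0 r') <= 16 * (M / (normc c * r' ^+ n.+1)) * r'.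
  have <- : square_int h r' = square_int i0 r'.
    by apply/eqP; rewrite -subr_eq0 -(square_intB dh di r'0 r'rho) k0.
  apply: (square_int_bound dh r'0 r'rho) => w /andP[rw wr].
  have w0 : w != 0 by rewrite -normc_gt0 (lt_le_trans r'0).
  rewrite /h Normc.normcM Normc.normcV Normc.normcM normcX.
  apply: ler_pM; rewrite ?normc_ge0 ?invr_ge0 ?mulr_ge0 ?exprn_ge0 ?normc_ge0 //.
    by apply: qM; exact: le_lt_trans wr r'rho.
  rewrite lef_pV2 ?posrE ?mulr_gt0 ?exprn_gt0 ?normc_gt0 //.
  by rewrite ler_pM2l // lerXn2r ?nnegrE ?normc_ge0 // ltW.
move/(le_trans (square_int_inv r'0)).
have -> : 16 * (M / (normc c * r' ^+ n.+1)) * r' = 2 * ((8 / r' ^+ n * M) / normc c).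
  by rewrite exprS; field; rewrite !gt_eqF // exprn_gt0.
by rewrite ler_pMr // ler_pdivlMr // mul1r.
Qed.

Lemma derive_bound rho : 0 < rho -> exists2 K : R, 0 < K &
  forall b z M,
    (forall w, normc (w - z) < rho -> derivable b w 1) ->
    (forall w, normc (w - z) < rho -> normc (b w - b z) <= M) ->
    normc ('D_1 b z) <= K * M.
Proof.
move=> rho0; have [K K0 KP] := cauchy_coef 1 rho0; exists K => // b z M db bM.
have zw (w : C) : z + w - z = w by rewrite addrC addKr.
apply: (KP (fun w => b (z + w) - b z)).
- move=> w wr; apply: derivable_sub; last exact: derivable_const.
  have : derivable b (z + w) 1 by apply: db; rewrite zw.
  by rewrite /derivable /=; under eq_fun do rewrite addrCA.
- by move=> w wr; apply: bM; rewrite zw.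
- move=> e e0; have /derivable_epsP/(_ e e0)[d d0 dP] : derivable b z 1.
    by apply: db; rewrite subrr Normc.normc0.
  by exists d => // w wd; rewrite !expr1; exact: dP.
Qed.

End Cauchy.

(** * Second-order Taylor bound *)
Section Taylor.
Variable R : realType.
Local Notation C := R[i]^o.
Implicit Types (b : C -> C) (rho : R).

Lemma is_derive_eps (f : R -> R) (x l : R) :
  (forall e, 0 < e -> exists2 d, 0 < d &
     forall h, `|h| < d -> `|f (x + h) - f x - l * h| <= e * `|h|) ->
  is_derive x 1 f l.
Proof.
move=> H.
have cv : (fun h : R => h^-1 *: (f (h *: 1 + x) - f x)) @ (dnbhs (0 : R)) --> l.
  apply/cvgrPdist_le => e e0; have [d d0 dP] := H e e0.
  near=> h.
  have h0 : h != 0 by near: h; exact: nbhs_dnbhs_neq.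
  have hd : `|h| < d by near: h; exact: dnbhs0_lt.
  have := dP h hd; rewrite -ler_pdivrMr ?normr_gt0 //; apply: le_trans.
  rewrite -normf_div distrC [h *: 1]mulr1 (addrC h).
  have -> // : h^-1 *: (f (x + h) - f x) - l = (f (x + h) - f x - l * h) / h.
  by rewrite [RHS]mulrBl mulfK // [X in X - _]mulrC.
apply: DeriveDef; first by apply/cvg_ex; exists l.
exact/cvg_lim.
Unshelve. all: by end_near. Qed.

Lemma mvt_real (phi dphi : R -> R) K : 
  (forall t : R, 0 <= t <= 1 -> is_derive t 1 phi (dphi t)) ->
  (forall t : R, 0 <= t <= 1 -> `|dphi t| <= K) -> `|phi 1 - phi 0| <= K.
Proof.
move=> H HK; have [t||c] := @MVT_segment R phi dphi 0 1 ler01.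
- rewrite in_itv /= => /andP[t1 t2]; apply: H; lra.
- apply: continuous_in_subspaceT => t; rewrite inE /= in_itv /= => t01.
  by apply/differentiable_continuous/derivable1_diffP; case: (H t t01).
- by rewrite in_itv /= => c01 ->; rewrite subr0 mulr1; exact: HK.
Qed.

(** The factor 2 again comes from applying the real mean value theorem to real and
    imaginary parts. Subtracting m allows the derivative to be compared with a
    fixed value. *)
Lemma mvt_complex b (z d m : C) K :
  (forall t : R, 0 <= t <= 1 -> derivable b (z + t%:C * d) 1) ->
  (forall t : R, 0 <= t <= 1 -> normc ('D_1 b (z + t%:C * d) - m) <= K) ->
  normc (b (z + d) - b z - m * d) <= 2 * (K * normc d).
Proof.
move=> db bK.
pose g (t : R) : C := b (z + t%:C * d) - t%:C * (m * d).
pose dg (t : R) : C := ('D_1 b (z + t%:C * d) - m) * d.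
have -> : b (z + d) - b z - m * d = g 1 - g 0.
  by rewrite /g !mul0r !mul1r subr0 addr0; ring.
have gP t : 0 <= t <= 1 -> forall e, 0 < e -> exists2 r, 0 < r &
    forall h : R, `|h| < r -> normc (g (t + h) - g t - dg t * h%:C) <= e * `|h|.
  move=> t01 e e0; have dP := derivable_epsP (db _ t01).
  have nd1 : 0 < normc d + 1 by have := normc_ge0 d; lra.
  have [|r r0 rP] := dP (e / (normc d + 1)); first by rewrite divr_gt0.
  exists (r / (normc d + 1)); first by rewrite divr_gt0.
  move=> h; rewrite ltr_pdivlMr // => hr.
  have hd : normc (h%:C * d) <= `|h| * (normc d + 1).
    by rewrite Normc.normcM normc_real ler_wpM2l // lerDl.
  have := rP (h%:C * d) (le_lt_trans hd hr).
  have -> : g (t + h) - g t - dg t * h%:C = b (z + t%:C * d + h%:C * d) - b (z + t%:C * d)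
     - 'D_1 b (z + t%:C * d) * (h%:C * d).
    rewrite /g /dg.
    have -> : z + (t + h)%:C * d = z + t%:C * d + h%:C * d.
      by rewrite rmorphD mulrDl addrA.
    rewrite rmorphD; ring.
  move/le_trans; apply; apply: le_trans (ler_wpM2l _ hd) _; first by rewrite divr_ge0 // ltW.
  by rewrite le_eqVlt; apply/orP; left; apply/eqP; field; rewrite gt_eqF.
have dgK t : 0 <= t <= 1 -> normc (dg t) <= K * normc d.
  by move=> t01; rewrite Normc.normcM ler_wpM2r ?normc_ge0 // bK.
apply: le_trans (normc_le_ReIm _) _; rewrite mulr_natl mulr2n.
apply: lerD.
- rewrite raddfB.
  apply: (@mvt_real (fun t => complex.Re (g t)) (fun t => complex.Re (dg t)) (K * normc d)).
    move=> t t01; apply: is_derive_eps => e e0; have [r r0 rP] := gP t t01 e e0.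
    exists r => // h hr; apply: le_trans (rP h hr); apply: le_trans (Re_le_normc _).
    by rewrite !raddfB /=; case: (dg t) => u v /=; rewrite mulr0 subr0.
  by move=> t /dgK; apply: le_trans; exact: Re_le_normc.
- rewrite raddfB.
  apply: (@mvt_real (fun t => complex.Im (g t)) (fun t => complex.Im (dg t)) (K * normc d)).
    move=> t t01; apply: is_derive_eps => e e0; have [r r0 rP] := gP t t01 e e0.
    exists r => // h hr; apply: le_trans (rP h hr); apply: le_trans (Im_le_normc _).
    by rewrite !raddfB /=; case: (dg t) => u v /=; rewrite mulr0 add0r.
  by move=> t /dgK; apply: le_trans; exact: Im_le_normc.
Qed.

(** By [derive_bound] the derivative is bounded near 0, so b is Lipschitz there.
    Hence w |-> b(w + z) - b(w) is O(z), and the Cauchy estimate of its first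
    coefficient gives |b'(z) - b'(0)| = O(z). The mean value inequality concludes. *)
Lemma taylor2 b rho : 0 < rho -> (forall w, normc w < rho -> derivable b w 1) ->
  exists L d, [/\ 0 <= L, 0 < d &
    forall w, normc w < d -> normc (b w - b 0 - 'D_1 b 0 * w) <= L * normc w ^+ 2].
Proof.
move=> rho0 db.
have [r1 r10 [r1rho r1P]] : exists2 r, 0 < r & r <= rho /\
    forall w, normc w < r -> normc (b w - b 0) <= 1.
  have : derivable b 0 1 by apply: db; rewrite Normc.normc0.
  move=> /derivable_cont /cvg_complexP/(_ 1 ltr01)/nbhs_complexP[d d0 dP].
  exists (Num.min d rho); first by rewrite lt_min d0.
  split; first by rewrite ge_min lexx orbT.
  move=> w; rewrite lt_min => /andP[wd _]; apply/ltW/dP.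
  by rewrite subr0.
pose r := r1 / 4.
have r0 : 0 < r by rewrite divr_gt0.
have r4 : 4 * r = r1 by rewrite /r; lra.
have tri (u v : R[i]) : normc u <= normc (u - v) + normc v.
  by have := le_normcD (u - v) v; rewrite subrK.
have [K K0 KP] := derive_bound r0.
have b2 u v : normc u < r1 -> normc v < r1 -> normc (b u - b v) <= 2.
  move=> /r1P h1 /r1P h2.
  have -> : b u - b v = (b u - b 0) - (b v - b 0) by ring.
  by apply: le_trans (le_normcD _ _) _; rewrite normcN; lra.
have dbK z : normc z < 2 * r -> normc ('D_1 b z) <= K * 2.
  move=> zr; apply: KP.
    by move=> w wz; apply: db; have := tri w z; lra.
  by move=> w wz; apply: b2; last lra; have := tri w z; lra.
have lip z d : normc z < r -> normc d < r -> normc (b (z + d) - b z) <= 4 * K * normc d.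
  move=> zr dr.
  have small t : 0 <= t <= 1 -> normc (z + t%:C * d) < 2 * r.
    move=> /andP[t0 t1]; apply: le_lt_trans (le_normcD _ _) _.
    rewrite Normc.normcM normc_real ger0_norm //.
    have : t * normc d <= normc d by rewrite ler_piMl ?normc_ge0.
    by lra.
  have := @mvt_complex b z d 0 (K * 2); rewrite mul0r subr0.
  have -> : 2 * (K * 2 * normc d) = 4 * K * normc d by ring.
  apply.
  - by move=> t t01; apply: db; have := small t t01; lra.
  - by move=> t t01; rewrite subr0; apply: dbK; exact: small.
have [K2 K20 K2P] := cauchy_coef 1 r0.
(* The function w |-> (b(w + z) - b(w)) - (b(z) - b(0)) has derivative
    b'(z) - b'(0) at 0. *)
have dlip z : normc z < r -> normc ('D_1 b z - 'D_1 b 0) <= K2 * (8 * K * normc z).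
  move=> zr.
  have n0 : normc (0 : R[i]) < r by rewrite Normc.normc0.
  apply: (K2P (fun w => (b (w + z) - b w) - (b z - b 0))).
  - move=> w wr; apply: derivable_sub; last exact: derivable_const.
    apply: derivable_sub; last by apply: db; lra.
    have : derivable b (w + z) 1 by apply: db; have := le_normcD w z; lra.
    by rewrite /derivable /=; under eq_fun do rewrite addrA.
  - move=> w wr; apply: le_trans (le_normcD _ _) _; rewrite normcN.
    have h1 := lip w z wr zr; have := lip 0 z n0 zr; rewrite add0r => h2.
    by lra.
  - move=> e e0; have e20 : 0 < e / 2 by rewrite divr_gt0.
    have [d1 d10 d1P] : exists2 d, 0 < d & forall w, normc w < d ->
        normc (b (z + w) - b z - 'D_1 b z * w) <= e / 2 * normc w.
      by apply: derivable_epsP => //; apply: db; lra.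
    have [d2 d20 d2P] : exists2 d, 0 < d & forall w, normc w < d ->
        normc (b (0 + w) - b 0 - 'D_1 b 0 * w) <= e / 2 * normc w.
      by apply: derivable_epsP => //; apply: db; lra.
    exists (Num.min d1 d2); first by rewrite lt_min d10.
    move=> w; rewrite lt_min !expr1 => /andP[/d1P h1 /d2P h2].
    have -> : b (w + z) - b w - (b z - b 0) - ('D_1 b z - 'D_1 b 0) * w =
      (b (z + w) - b z - 'D_1 b z * w) - (b (0 + w) - b 0 - 'D_1 b 0 * w).
      rewrite add0r (addrC w).
      by move: ('D_1 b z) ('D_1 b 0) (b (z + w)) (b w) (b z) (b 0) => u1 u2 u3 u4 u5 u6; ring.
    apply: le_trans (le_normcD _ _) _; rewrite normcN.
    by apply: le_trans (lerD h1 h2) _; rewrite -mulrDl -splitr.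
exists (2 * (K2 * (8 * K))), r; split => //.
  by rewrite !mulr_ge0 // ltW.
move=> w wr; have := @mvt_complex b 0 w ('D_1 b 0) (K2 * (8 * K * normc w)).
rewrite add0r expr2.
have -> : 2 * (K2 * (8 * K * normc w) * normc w) = 2 * (K2 * (8 * K)) * (normc w * normc w) by ring.
have small t : 0 <= t <= 1 -> normc (0 + t%:C * w) <= normc w.
  move=> /andP[t0 t1]; rewrite add0r Normc.normcM normc_real ger0_norm //.
  by rewrite ler_piMl ?normc_ge0.
apply.
- by move=> t t01; apply: db; have := small t t01; lra.
- move=> t t01; have s1 := small t t01; apply: le_trans (dlip _ (le_lt_trans s1 wr)) _.
  by rewrite ler_pM2l // ler_pM2l // mulr_gt0.
Qed.

End Taylor.

(** * Invariants of 3x3 matrices *)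
Section Matrix3.
Variable F : comNzRingType.
Implicit Types (M N : 'M[F]_3).

Lemma ord3E : (ord0 = 0 :> 'I_3) * (lift ord0 ord0 = 1 :> 'I_3) *
  (lift ord0 (lift ord0 ord0) = 2 :> 'I_3).
Proof. by do !split; apply: val_inj. Qed.

Lemma forall_ord3 (P : 'I_3 -> Prop) : P 0 -> P 1 -> P 2 -> forall i, P i.
Proof.
move=> P0 P1 P2 [[|[|[|//]]] i3].
- by have -> : Ordinal i3 = 0 by exact: val_inj.
- by have -> : Ordinal i3 = 1 by exact: val_inj.
- by have -> : Ordinal i3 = 2 by exact: val_inj.
Qed.

Lemma big_ord3 (f : 'I_3 -> F) : \sum_i f i = f 0 + f 1 + f 2.
Proof. by rewrite !big_ord_recl big_ord0 addr0 addrA !ord3E. Qed.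

Lemma det3 M : \det M =
  M 0 0 * M 1 1 * M 2 2 - M 0 0 * M 1 2 * M 2 1 - M 0 1 * M 1 0 * M 2 2
  + M 0 1 * M 1 2 * M 2 0 + M 0 2 * M 1 0 * M 2 1 - M 0 2 * M 1 1 * M 2 0.
Proof.
have det2 (N : 'M[F]_2) : \det N = N 0 0 * N 1 1 - N 0 1 * N 1 0.
  rewrite (expand_det_row _ ord0) !big_ord_recl big_ord0 /cofactor !det_mx11 !mxE /=.
  have E1 : lift ord0 ord0 = 1 :> 'I_2 by apply: val_inj.
  have E2 : lift 1 ord0 = 0 :> 'I_2 by apply: val_inj.
  have E3 : ord0 = 0 :> 'I_2 by [].
  rewrite /= ?E1 ?E2 ?E3 expr0 expr1.
  ring.
rewrite (expand_det_row _ 0) big_ord3 /cofactor !det2 !mxE /=.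
rewrite expr0 expr1 expr2.
have -> : lift 0 0 = 1 :> 'I_3 by apply: val_inj.
have -> : lift 0 1 = 2 :> 'I_3 by apply: val_inj.
have -> : lift 1 0 = 0 :> 'I_3 by apply: val_inj.
have -> : lift 1 1 = 2 :> 'I_3 by apply: val_inj.
have -> : lift 2 0 = 0 :> 'I_3 by apply: val_inj.
have -> : lift 2 1 = 1 :> 'I_3 by apply: val_inj.
ring.
Qed.

Definition sig2 M := M 0 0 * M 1 1 + M 0 0 * M 2 2 + M 1 1 * M 2 2
  - M 0 1 * M 1 0 - M 0 2 * M 2 0 - M 1 2 * M 2 1.

Lemma mxtrace3 M : \tr M = M 0 0 + M 1 1 + M 2 2.
Proof. exact: big_ord3. Qed.

Lemma char_poly3 M x : (char_poly M).[x] = x ^+ 3 - \tr M * x ^+ 2 + sig2 M * x - \det M.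
Proof.
have -> : (char_poly M).[x] = \det (x%:M - M).
  rewrite /char_poly -horner_evalE -det_map_mx; congr (\det _).
  by apply/matrixP => i j; rewrite !mxE /= ?horner_evalE !(hornerE, hornerMn).
rewrite !det3 mxtrace3 /sig2 !mxE /=; ring.
Qed.

End Matrix3.

(** * The spectral ball and the matrix B *)
Section Spectral.
Variable R : realType.
Local Notation C := R[i].

(** The characteristic polynomial is a product of three factors x - z with |z| < 1. *)
Lemma char_poly_bound (M : 'M[C]_3) (x : C) : spectral_ball R 3 M ->
  normc (char_poly M).[x] <= (normc x + 1) ^+ 3.
Proof.
move=> MO; have [r rE] := closed_field_poly_normal (char_poly M).
have := char_poly_monic M; rewrite monicE => /eqP lc; rewrite lc scale1r in rE.
have sr : size r = 3%N.
  by apply: succn_inj; rewrite -(size_char_poly M) rE size_prod_XsubC.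
have rP z : z \in r -> normc z < 1.
  by move=> zr; apply: MO; rewrite eigenvalue_root_char rE root_prod_XsubC.
rewrite rE horner_prod -sr; elim: r {rE sr} rP => [|z r IH] rP.
  by rewrite big_nil expr0 Normc.normc1.
rewrite big_cons Normc.normcM /= exprS ler_pM ?normc_ge0 //.
  rewrite hornerXsubC (le_trans (le_normcD _ _)) // normcN lerD2l ltW // rP //.
  by rewrite inE eqxx.
by apply: IH => y yr; apply: rP; rewrite inE yr orbT.
Qed.

Lemma det_bound (M : 'M[C]_3) : spectral_ball R 3 M -> normc (\det M) <= 1.
Proof.
move=> /(char_poly_bound 0); rewrite char_poly3 Normc.normc0 add0r expr1n.
by rewrite !expr0n /= !mulr0 subr0 addr0 add0r normcN.
Qed.

(** The values of the characteristic polynomial at 1 and -1 have modulus at most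
    8, and their difference is 2 + 2 sig2 M. *)
Lemma sig2_bound (M : 'M[C]_3) : spectral_ball R 3 M -> normc (sig2 M) <= 9.
Proof.
move=> MO; have := char_poly_bound 1 MO; have := char_poly_bound (-1) MO.
rewrite !char_poly3 normcN Normc.normc1; set p1 := (X in normc X <= _ -> _).
set p2 := (X in _ -> normc X <= _ -> _) => h1 h2.
have E : 2%:R * sig2 M = p2 - p1 - 2%:R by rewrite /p1 /p2; ring.
have n2 : normc (2%:R : C) = 2.
  by have := normc_real (2 : R); rewrite rmorph_nat normr_nat.
have : normc (2%:R * sig2 M) <= 18.
  rewrite E; apply: le_trans (le_normcD _ _) _; rewrite normcN n2.
  have := le_normcD p2 (- p1); rewrite normcN.
  have e8 : (1 + 1) ^+ 3 = 8 :> R by ring.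
  by rewrite e8 in h1 h2; lra.
by rewrite Normc.normcM n2; lra.
Qed.

Lemma omega_sum0 : 1 + omega R + omega R ^+ 2 = 0.
Proof.
pose x : R := 2 * pi / 3.
have wE : omega R = cos x +i* sin x.
  rewrite /omega /cexp.
  have -> : 2 * pi%:C * 'i / 3 = 0 +i* x :> C.
    have -> : 2 * pi%:C * 'i / 3 = x%:C * 'i by rewrite /x !(rmorphM, fmorphV, rmorph_nat) /=;
        field.
    by apply/eqP; rewrite eq_complex /=; apply/andP; split; apply/eqP; ring.
  by rewrite /= expR0 mul1r.
have mulE a b : (cos a +i* sin a) * (cos b +i* sin b) = cos (a + b) +i* sin (a + b) :> C.
  rewrite cosD sinD; apply/eqP; rewrite eq_complex /=; apply/andP; split; apply/eqP; ring.
have w3 : omega R ^+ 3 = 1.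
  rewrite wE !exprS expr0 mulr1 !mulE.
  have -> : x + (x + x) = pi *+ 2 by rewrite /x mulr2n; field.
  by rewrite cos2pi sin2pi.
have w1 : omega R - 1 != 0.
  rewrite subr_eq0 wE eq_complex negb_and; apply/orP; right => /=.
  have pp := pi_gt0 R.
  by rewrite gt_eqF // sin_gt0_pi // /x; apply/andP; split; lra.
apply: (mulfI w1); rewrite mulr0; have /eqP := w3; rewrite -subr_eq0 => /eqP <-; ring.
Qed.

Lemma matB00 : matB R 0 0 = 1.
Proof. by rewrite !mxE eqxx mulr1n; exact: expr0. Qed.

Lemma matB11 : matB R 1 1 = omega R.
Proof. by rewrite !mxE eqxx mulr1n; exact: expr1. Qed.

Lemma matB22 : matB R 2 2 = omega R ^+ 2.
Proof. by rewrite !mxE eqxx mulr1n. Qed.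

Lemma matB_off i j : i != j -> matB R i j = 0.
Proof. by move=> ij; rewrite !mxE (negbTE ij). Qed.

End Spectral.

(** * The defect det f - s z sig2 f *)
Section Kobayashi.
Variable R : realType.
Local Notation C := R[i]^o.
Implicit Types (g : C -> C) (n m : nat).

Definition order_ge n g := exists2 L : R, 0 <= L &
  \forall w \near nbhs (0 : C), normc (g w) <= L * normc w ^+ n.

Lemma order_ge_add n f g : order_ge n f -> order_ge n g -> order_ge n (fun w => f w + g w).
Proof.
move=> [K K0 KP] [L L0 LP]; exists (K + L); first exact: addr_ge0.
near=> w; apply: le_trans (le_normcD _ _) _; rewrite mulrDl.
by apply: lerD; near: w.
Unshelve. all: by end_near. Qed.

Lemma order_ge_opp n g : order_ge n g -> order_ge n (fun w => - g w).
Proof. by move=> [L L0 LP]; exists L => //; near=> w; rewrite normcN; near: w.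
Unshelve. all: by end_near. Qed.

Lemma order_ge_sub n f g : order_ge n f -> order_ge n g -> order_ge n (fun w => f w - g w).
Proof. by move=> fP gP; exact: order_ge_add fP (order_ge_opp gP). Qed.

Lemma order_ge_mul n m f g : order_ge n f -> order_ge m g -> order_ge (n + m) (fun w => f w * g w).
Proof.
move=> [K K0 KP] [L L0 LP]; exists (K * L); first exact: mulr_ge0.
near=> w; rewrite Normc.normcM exprD mulrACA.
by apply: ler_pM; rewrite ?normc_ge0 //; near: w.
Unshelve. all: by end_near. Qed.

Lemma order_ge_weak m n g : (m <= n)%N -> order_ge n g -> order_ge m g.
Proof.
move=> mn [L L0 LP]; exists L => //.
have : \forall w \near nbhs (0 : C), normc w < 1.
  by apply/nbhs_complexP; exists 1 => // w; rewrite subr0.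
move=> h1; near=> w; have w1 : normc w < 1 by near: w.
have wL : normc (g w) <= L * normc w ^+ n by near: w.
apply: le_trans wL _; apply: ler_wpM2l => //.
by apply: ler_wiXn2l; rewrite ?normc_ge0 // ltW.
Unshelve. all: by end_near. Qed.

Lemma order_ge_cst (c : C) : order_ge 0 (fun=> c).
Proof.
exists (normc c); first exact: normc_ge0.
by near=> w; rewrite expr0 mulr1.
Unshelve. all: by end_near. Qed.

Lemma order_ge_scal (c : C) : order_ge 1 (fun w => c * w).
Proof.
exists (normc c); first exact: normc_ge0.
by near=> w; rewrite Normc.normcM expr1.
Unshelve. all: by end_near. Qed.

Lemma order_ge_littleo n g : order_ge n.+1 g -> forall e : R, 0 < e -> exists2 d, 0 < d &
  forall w, normc w < d -> normc (g w) <= e * normc w ^+ n.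
Proof.
move=> [L L0 /nbhs_complexP[d d0 dP]] e e0.
have L1 : 0 < L + 1 by rewrite ltr_wpDl.
exists (Num.min d (e / (L + 1))); first by rewrite lt_min d0 divr_gt0.
move=> w; rewrite lt_min => /andP[wd we].
apply: le_trans (dP w _) _; first by rewrite subr0.
rewrite exprS mulrA ler_wpM2r ?exprn_ge0 ?normc_ge0 //.
rewrite ltr_pdivlMr // in we; apply: le_trans (ltW we).
by rewrite mulrC ler_wpM2l ?normc_ge0 // lerDl.
Qed.

(** Here x = s z, and the e_ij are the remainders of order 2 of the entries. Each
    monomial on the right has order at least 4, since g1 and g2 have order 1. The
    terms x g3 e21, which have order 3, cancel between det and x sig2, while
    1 + om + om^2 = 0 removes the terms in x^2 of the diagonal part of sig2 and
    gives om^3 = 1. *)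
Lemma defect_identity (A : comNzRingType) (om x e00 e01 e02 e10 e11 e12 e20 e21 e22 : A) :
  1 + om + om ^+ 2 = 0 ->
  let g1 := om * x + e11 in let g2 := om ^+ 2 * x + e22 in let g3 := 1 + e12 in
  (x + e00) * g1 * g2 - (x + e00) * g3 * e21 - e01 * e10 * g2 + e01 * g3 * e20
    + e02 * e10 * e21 - e02 * g1 * e20
    - x * ((x + e00) * g1 + (x + e00) * g2 + g1 * g2 - e01 * e10 - e02 * e20 - g3 * e21)
    - x ^+ 3
  = e00 * g1 * g2 + x * e11 * g2 + (om * (x * x)) * e22
    - e00 * g3 * e21 - e01 * e10 * g2 + e01 * g3 * e20
    + e02 * e10 * e21 - e02 * g1 * e20
    - x * (e00 * (g1 + g2) + x * (e11 + e22) + e11 * g2 + om * x * e22)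
    + x * (e01 * e10 + e02 * e20).
Proof.
move=> w2 /=; have {}w2 : om ^+ 2 = - 1 - om by apply/eqP; rewrite -subr_eq0 -w2; apply/eqP; ring.
ring: w2.
Qed.

Lemma kobayashi_defect_order (E : 'I_3 -> 'I_3 -> C -> C) (f : C -> 'M[R[i]]_3) (s : C) :
  (forall i j, order_ge 2 (E i j)) ->
  (forall w i j, f w i j = matA R i j + s * matB R i j * w + E i j w) ->
  order_ge 4 (fun w => \det (f w) - s * w * sig2 (f w) - s ^+ 3 * w ^+ 3).
Proof.
move=> EO fE; have w2 := omega_sum0 R; set om := omega R in w2.
pose x (w : C) : C := s * w.
have B11 : matB R 1 1 = om := matB11 R.
have B22 : matB R 2 2 = om ^+ 2 := matB22 R.
have f00 w : f w 0 0 = x w + E 0 0 w by rewrite fE !mxE /= /x; ring.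
have f11 w : f w 1 1 = om * x w + E 1 1 w by rewrite fE B11 !mxE /= /x; ring.
have f22 w : f w 2 2 = om ^+ 2 * x w + E 2 2 w by rewrite fE B22 !mxE /= /x; ring.
have f12 w : f w 1 2 = 1 + E 1 2 w by rewrite fE !mxE /=; ring.
have f01 w : f w 0 1 = E 0 1 w by rewrite fE !mxE /=; ring.
have f02 w : f w 0 2 = E 0 2 w by rewrite fE !mxE /=; ring.
have f10 w : f w 1 0 = E 1 0 w by rewrite fE !mxE /=; ring.
have f20 w : f w 2 0 = E 2 0 w by rewrite fE !mxE /=; ring.
have f21 w : f w 2 1 = E 2 1 w by rewrite fE !mxE /=; ring.
pose g1 w := om * x w + E 1 1 w; pose g2 w := om ^+ 2 * x w + E 2 2 w.
pose g3 w := 1 + E 1 2 w.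
have xO : order_ge 1 x := order_ge_scal s.
have cO (c : C) := order_ge_cst c.
have E1 i j : order_ge 1 (E i j) by apply: order_ge_weak (EO i j).
have g1O : order_ge 1 g1 := order_ge_add (order_ge_mul (cO om) xO) (E1 1 1).
have g2O : order_ge 1 g2 := order_ge_add (order_ge_mul (cO (om ^+ 2)) xO) (E1 2 2).
have g3O : order_ge 0 g3 by apply: order_ge_add (cO 1) _; apply: order_ge_weak (EO 1 2).
have -> : (fun w => \det (f w) - s * w * sig2 (f w) - s ^+ 3 * w ^+ 3) =
  (fun w => E 0 0 w * g1 w * g2 w + x w * E 1 1 w * g2 w + (om * (x w * x w)) * E 2 2 w
   - E 0 0 w * g3 w * E 2 1 w - E 0 1 w * E 1 0 w * g2 w + E 0 1 w * g3 w * E 2 0 w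
   + E 0 2 w * E 1 0 w * E 2 1 w - E 0 2 w * g1 w * E 2 0 w
   - x w * (E 0 0 w * (g1 w + g2 w) + x w * (E 1 1 w + E 2 2 w) + E 1 1 w * g2 w
            + om * x w * E 2 2 w)
   + x w * (E 0 1 w * E 1 0 w + E 0 2 w * E 2 0 w)).
  apply/funext => w; rewrite det3 /sig2 f00 f11 f22 f12 f01 f02 f10 f20 f21 /g1 /g2 /g3.
  rewrite -exprMn -/(x w).
  exact: (@defect_identity R[i] om (x w) (E 0 0 w) (E 0 1 w) (E 0 2 w) (E 1 0 w) (E 1 1 w)
    (E 1 2 w) (E 2 0 w) (E 2 1 w) (E 2 2 w) w2).
have W n g : (4 <= n)%N -> order_ge n g -> order_ge 4 g by exact: order_ge_weak.
have EEO i j k l : order_ge 4 (fun w => E i j w * E k l w) := order_ge_mul (EO i j) (EO k l).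
apply: order_ge_add; first apply: order_ge_sub; first apply: order_ge_sub; first apply:
    order_ge_add;
  first apply: order_ge_add; first apply: order_ge_sub; first apply: order_ge_sub; first apply:
      order_ge_add;
  first apply: order_ge_add.
- exact: order_ge_mul (order_ge_mul (EO 0 0) g1O) g2O.
- exact: order_ge_mul (order_ge_mul xO (EO 1 1)) g2O.
- exact: order_ge_mul (order_ge_mul (cO om) (order_ge_mul xO xO)) (EO 2 2).
- exact: order_ge_mul (order_ge_mul (EO 0 0) g3O) (EO 2 1).
- by apply: W (order_ge_mul (EEO 0 1 1 0) g2O).
- exact: order_ge_mul (order_ge_mul (EO 0 1) g3O) (EO 2 0).
- by apply: W (order_ge_mul (EEO 0 2 1 0) (EO 2 1)).
- by apply: W (order_ge_mul (order_ge_mul (EO 0 2) g1O) (EO 2 0)).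
- apply: (order_ge_mul xO (m := 3)); do 2?apply: order_ge_add; first apply: order_ge_add.
  + exact: order_ge_mul (EO 0 0) (order_ge_add g1O g2O).
  + exact: order_ge_mul xO (order_ge_add (EO 1 1) (EO 2 2)).
  + exact: order_ge_mul (EO 1 1) g2O.
  + exact: order_ge_mul (order_ge_mul (cO om) xO) (EO 2 2).
- by apply: W (order_ge_mul xO (order_ge_add (EEO 0 1 1 0) (EEO 0 2 2 0))).
Qed.

End Kobayashi.

(** * Positivity of the Kobayashi metric *)
Section KobayashiPos.
Variable R : realType.
Local Notation C := R[i]^o.

Lemma derivable_det3 (g : C -> 'M[R[i]]_3) (z : C) :
  (forall i j, derivable (fun w => g w i j : C) z 1) ->
  derivable (fun w => \det (g w) : C) z 1.
Proof.
move=> dg.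
have d3 i j k l m n : derivable (fun w => g w i j * g w k l * g w m n : C) z 1.
  exact: (derivable_mul (derivable_mul (dg i j) (dg k l)) (dg m n)).
have -> : (fun w => \det (g w) : C) = (fun w =>
    g w 0 0 * g w 1 1 * g w 2 2 - g w 0 0 * g w 1 2 * g w 2 1 - g w 0 1 * g w 1 0 * g w 2 2
    + g w 0 1 * g w 1 2 * g w 2 0 + g w 0 2 * g w 1 0 * g w 2 1 - g w 0 2 * g w 1 1 * g w 2 0 : C).
  by apply/funext => w; rewrite det3.
exact: (derivable_sub (derivable_add (derivable_add (derivable_sub (derivable_sub
  (d3 0 0 1 1 2 2) (d3 0 0 1 2 2 1)) (d3 0 1 1 0 2 2)) (d3 0 1 1 2 2 0)) (d3 0 2 1 0 2 1))
  (d3 0 2 1 1 2 0)).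
Qed.

Lemma derivable_sig2 (g : C -> 'M[R[i]]_3) (z : C) :
  (forall i j, derivable (fun w => g w i j : C) z 1) ->
  derivable (fun w => sig2 (g w) : C) z 1.
Proof.
move=> dg.
have d2 i j k l : derivable (fun w => g w i j * g w k l : C) z 1.
  exact: (derivable_mul (dg i j) (dg k l)).
exact: (derivable_sub (derivable_sub (derivable_sub (derivable_add (derivable_add
  (d2 0 0 1 1) (d2 0 0 2 2)) (d2 1 1 2 2)) (d2 0 1 1 0)) (d2 0 2 2 0)) (d2 1 2 2 1)).
Qed.

(** The bound |s|^3 <= K (1 + 9 |s|) forces |s| <= 1 + 10 K: if |s| > 1, it gives
    |s|^3 <= 10 K |s|. *)
Lemma kobayashi_gt0 :
  (0 < kobayashi (spectral_ball R 3 : set ('M[R[i]]_3 : normedModType R[i])) (matA R) (matB R))%E.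
Proof.
have [K K0 KP] := cauchy_coef 3 (@ltr01 R).
have c0 : 0 < 1 + 10 * K by rewrite ltr_wpDr // mulr_ge0 // ltW.
apply: (@lt_le_trans _ _ ((1 + 10 * K)^-1)%:E); first by rewrite lte_fin invr_gt0.
apply: le_ereal_inf_tmp => _ [a [f [fh f0 fB]] <-]; rewrite lee_fin.
have B00 := matB00 R.
have a0 : a != 0.
  apply/eqP => a0; move/matrixP/(_ 0 0): fB; rewrite a0 scale0r B00 mxE => /eqP.
  by rewrite eq_sym oner_eq0.
pose s : C := a^-1.
have disc0 : unit_disc (0 : C).
  by have n0 : normc (0 : R[i]) < 1; [rewrite Normc.normc0|exact: n0].
have df w : normc w < 1 -> forall i j, derivable (fun x => f x i j : C) w 1.
  by move=> w1; apply/derivable_mxE; case: (fh w w1).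
have Df i j : 'D_1 (fun x => f x i j : C) 0 = s * matB R i j.
  rewrite -derive1_mxE; last by case: (fh 0 disc0).
  by rewrite -fB mxE mulrA mulVf // mul1r.
pose E i j (w : C) : C := f w i j - matA R i j - s * matB R i j * w.
have EO i j : order_ge 2 (E i j).
  have [L [d [L0 d0 LP]]] := taylor2 (@ltr01 R) (fun w w1 => df w w1 i j).
  exists L => //; apply/nbhs_complexP; exists d => // w; rewrite subr0 => /LP.
  by rewrite Df f0.
have fE w i j : f w i j = matA R i j + s * matB R i j * w + E i j w.
  by rewrite /E; ring.
pose q (w : C) : C := \det (f w) - s * w * sig2 (f w).
have qs : normc (s ^+ 3) <= K * (1 + normc s * 9).
  apply: (KP q).
  - move=> w w1; apply: (@derivable_sub _ (fun w => \det (f w)) (fun w => s * w * sig2 (f w))).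
      exact: derivable_det3 (df w w1).
    apply: (@derivable_mul _ (fun w => s * w) (fun w => sig2 (f w))).
      exact: (derivable_mul (@derivable_const R s w) (@derivable_var R w)).
    exact: derivable_sig2 (df w w1).
  - move=> w w1; have [_ fO] := fh w w1.
    apply: le_trans (le_normcD _ _) _; rewrite normcN; apply: lerD; first exact: det_bound.
    rewrite Normc.normcM; apply: ler_pM; rewrite ?normc_ge0 ?sig2_bound //.
    by rewrite Normc.normcM ler_piMr ?normc_ge0 // ltW.
  - exact: (order_ge_littleo (kobayashi_defect_order EO fE)).
rewrite normcX in qs.
have -> : normc a = (normc s)^-1 by rewrite Normc.normcV invrK.
have s0 : 0 < normc s by rewrite normc_gt0 invr_eq0.
rewrite lef_pV2 ?posrE // leNgt; apply/negP => lt.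
have s1 : 1 < normc s by apply: le_lt_trans lt; rewrite lerDl mulr_ge0 // ltW.
have : K * (1 + normc s * 9) <= K * (10 * normc s) by rewrite ler_pM2l //; lra.
move=> /(le_trans qs); apply/negP; rewrite -ltNge.
have -> : K * (10 * normc s) = (10 * K) * normc s by ring.
apply: (@lt_le_trans _ _ (normc s * normc s)); first by rewrite ltr_pM2r //; lra.
by rewrite !exprS expr0 mulr1 ler_pM2l // ler_peMr // ltW.
Qed.

End KobayashiPos.

(** * Cyclic vectors and a companion form by shears *)
Section CyclicAlgebra.
Variable F : fieldType.
Implicit Types (M N : 'M[F]_3) (x : F).

(** For v = (x, 0, 1), [krylov1 M x] is M v, [krylov2 M x] is M^2 v, and
    [krylov_det M x] is the determinant of the matrix with columns M^2 v, M v, v,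
    which is nonzero exactly when v is cyclic. *)
Definition krylov1 M x (i : 'I_3) := x * M i 0 + M i 2.
Definition krylov2 M x (i : 'I_3) := M i 0 * krylov1 M x 0 + M i 1 * krylov1 M x 1 + M i 2 *
    krylov1 M x 2.
Definition krylov_det M x := krylov2 M x 0 * krylov1 M x 1 - krylov1 M x 0 * krylov2 M x 1
  + x * (krylov2 M x 1 * krylov1 M x 2 - krylov1 M x 1 * krylov2 M x 2).

Definition mx3 (a b c d e f g h k : F) : 'M[F]_3 :=
  \matrix_(i, j) nth 0 (nth [::] [:: [:: a; b; c]; [:: d; e; f]; [:: g; h; k]] i) j.

Lemma mx3P M N : (forall i j, M i j = N i j) -> M = N.
Proof. by move=> H; apply/matrixP. Qed.

Lemma mulmx3 M N i j : (M *m N) i j = M i 0 * N 0 j + M i 1 * N 1 j + M i 2 * N 2 j.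
Proof. by rewrite mxE big_ord3. Qed.

Definition shear_up (y x : F) := mx3 0 y x 0 0 0 0 0 0.
Definition shear_low (a b : F) := mx3 0 0 0 0 0 0 a b 0.
Definition shear_mid (a : F) := mx3 0 0 0 a 0 0 0 0 0.

Lemma shear_up_sq y x : shear_up y x *m shear_up y x = 0.
Proof.
apply/mx3P; do 2!apply: forall_ord3; rewrite mulmx3 !mxE /=; ring.
Qed.

Lemma shear_low_sq y x : shear_low y x *m shear_low y x = 0.
Proof.
apply/mx3P; do 2!apply: forall_ord3; rewrite mulmx3 !mxE /=; ring.
Qed.

Lemma shear_mid_sq y : shear_mid y *m shear_mid y = 0.
Proof.
apply/mx3P; do 2!apply: forall_ord3; rewrite mulmx3 !mxE /=; ring.
Qed.

(** The matrix of M in the basis w / k, M v / u, v, where v = (x, 0, 1) and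
    w = (M^2 - (tr M) M + sig2 M) v, so that M w = (det M) v by Cayley-Hamilton.
    The scalings u and k are the ones that make the matrix of this basis a product
    of three shears. *)
Definition companion M x :=
  let u := krylov1 M x 1 in let k := krylov_det M x / u in
  mx3 0 (k / u) 0  0 (\tr M) u  (\det M / k) (- sig2 M / u) 0.

(** The columns of P are w / k, M v / u, v. With u = (M v)_2 its lower right 2x2
    block is unipotent lower triangular, and with k = krylov_det / u its determinant
    is 1; so P = (1 + N1) (1 + N2) (1 + N3). It remains to check M P = P M'. *)
Lemma companion_conj M x : krylov1 M x 1 != 0 -> krylov_det M x != 0 ->
  exists N1 N2 N3 : 'M[F]_3, [/\ N1 *m N1 = 0, N2 *m N2 = 0, N3 *m N3 = 0 &
   M = (1%:M + N1) *m ((1%:M + N2) *m ((1%:M + N3) *m companion M x *m (1%:M - N3))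
         *m (1%:M - N2)) *m (1%:M - N1)].
Proof.
set u := krylov1 M x 1 => u0 D0; set k := krylov_det M x / u.
have k0 : k != 0 by rewrite mulf_neq0 // invr_eq0.
pose w i := krylov2 M x i - \tr M * krylov1 M x i.
pose w0 := (w 0 + sig2 M * x) / k; pose w1 := w 1 / k; pose w2 := (w 2 + sig2 M) / k.
pose y := krylov1 M x 0 / u; pose g := krylov1 M x 2 / u.
pose P := mx3 w0 y x w1 1 0 w2 g 1.
pose N1 := shear_up (y - x * g) x; pose N2 := shear_low (w2 - g * w1) g; pose N3 := shear_mid w1.
have kE : k = w 0 + sig2 M * x - y * w 1 + x * (w 1 * g - (w 2 + sig2 M)).
  apply: (mulIf u0); rewrite /k divfK // /y /g.
  have -> : (w 0 + sig2 M * x - krylov1 M x 0 / u * w 1 + x * (w 1 * (krylov1 M x 2 / u) - (w 2 +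
      sig2 M))) * u
    = (w 0 + sig2 M * x) * u - krylov1 M x 0 * w 1 + x * (w 1 * krylov1 M x 2 - (w 2 + sig2 M) * u).
    by field.
  rewrite /krylov_det -/u /w -/u; ring.
have PE : (1%:M + N1) *m (1%:M + N2) *m (1%:M + N3) = P.
  apply/mx3P; do 2!apply: forall_ord3; rewrite !mulmx3 !mxE /=; try ring.
  have -> : w0 = 1 + (y - x * g) * w1 + x * w2.
    apply: (mulIf k0); rewrite /w0 /w1 /w2 divfK //.
    have -> : (1 + (y - x * g) * (w 1 / k) + x * ((w 2 + sig2 M) / k)) * k =
       k + (y - x * g) * w 1 + x * (w 2 + sig2 M) by field.
    rewrite {1}kE; ring.
  ring.
pose v (i : 'I_3) := [:: x; 0; 1]`_i.
have P0 i : P i 0 = (w i + sig2 M * v i) / k.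
  by move: i; apply: forall_ord3; rewrite !mxE /v /= ?mulr0 ?mulr1 ?addr0.
have P1 i : P i 1 = krylov1 M x i / u by move: i; apply: forall_ord3; rewrite !mxE /= ?divff.
have P2 i : P i 2 = v i by move: i; apply: forall_ord3; rewrite !mxE.
have MP : M *m P = P *m companion M x.
  apply/mx3P => i; have CH : M i 0 * (w 0 + sig2 M * x) + M i 1 * w 1 + M i 2 * (w 2 + sig2 M)
      = \det M * v i.
    move: i; apply: forall_ord3; rewrite /v /= /w /krylov2 /krylov1 mxtrace3 det3 /sig2; ring.
  apply: forall_ord3; rewrite !mulmx3 !P0 !P1 !P2 [in RHS]mxE [in RHS]mxE [in RHS]mxE /=
    -/u -/k /v /=.
  - transitivity (\det M * v i / k); last by rewrite !mulr0 !add0r mulrCA mulrA.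
    by rewrite -CH mulr0 addr0 mulr1 !mulrA -!mulrDl.
  - transitivity (krylov2 M x i / u); first by rewrite /krylov2 -/u !mulrA -!mulrDl.
    rewrite mulrA divfK // /w; move: (u^-1) => u'; ring.
  - by rewrite !mulr0 add0r !addr0 mulr1 divfK // /krylov1 mulrC.
exists N1, N2, N3; split; [exact: shear_up_sq|exact: shear_low_sq|exact: shear_mid_sq|].
have inv N : N *m N = 0 -> (1%:M + N) *m (1%:M - N) = 1%:M.
  by move=> NN; rewrite mulmxBr mulmx1 mulmxDl mul1mx NN addr0 addrK.
rewrite !mulmxA PE -MP -PE -!mulmxA (mulmxA (1%:M + N3)) inv ?shear_mid_sq // mul1mx.
by rewrite (mulmxA (1%:M + N2)) inv ?shear_low_sq // mul1mx inv ?shear_up_sq // mulmx1.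
Qed.

End CyclicAlgebra.

(** * Discs through A and a given matrix *)
Section Reach.
Variable R : realType.
Local Notation C := R[i]^o.
Local Notation M3 := ('M[R[i]]_3 : normedModType R[i]).
Implicit Types (M N X : 'M[R[i]]_3) (alpha : C).

(** If |alpha| < 1, such a disc bounds the Lempert function of A and M by |alpha|. *)
Definition reach alpha M := exists f : C -> M3,
  [/\ holo_disc (spectral_ball R 3 : set M3) f, f 0 = matA R & f alpha = M].

(** An eigenvalue of modulus b >= 1 would satisfy
    b^3 < (b^2 + b + 1) / 3 <= b^3. *)
Lemma spectral_ball_small M : normc (\tr M) < 3^-1 -> normc (sig2 M) < 3^-1 ->
  normc (\det M) < 3^-1 -> spectral_ball R 3 M.
Proof.
move=> h1 h2 h3 a; rewrite eigenvalue_root_char => /rootP; rewrite char_poly3 => E.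
rewrite ltNge; apply/negP => a1; have a0 : 0 <= normc a by exact: normc_ge0.
have aE : a ^+ 3 = \tr M * a ^+ 2 - sig2 M * a + \det M.
  by apply/eqP; rewrite -subr_eq0; apply/eqP; rewrite -[RHS]E; ring.
have : normc a ^+ 3 <= normc (\tr M) * normc a ^+ 2 + normc (sig2 M) * normc a + normc (\det M).
  rewrite -normcX aE; apply: le_trans (le_normcD _ _) _; rewrite lerD2r.
  by apply: le_trans (le_normcD _ _) _; rewrite normcN (Normc.normcM (\tr M)) (Normc.normcM (sig2
      M)) normcX.
apply/negP; rewrite -ltNge.
move: (normc a) (normc (\tr M)) (normc (sig2 M)) (normc (\det M)) a1 a0 h1 h2 h3
  => b t s d b1 b0 ht hs hd.
have b2 : b <= b ^+ 2 by rewrite expr2 ler_peMr.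
have b3 : b ^+ 2 <= b ^+ 3 by rewrite [leRHS]exprS; apply: ler_peMl => //; exact: exprn_ge0.
have e1 : t * b ^+ 2 <= 3^-1 * b ^+ 2 by rewrite ler_wpM2r ?exprn_ge0 // ltW.
have e2 : s * b <= 3^-1 * b by rewrite ler_wpM2r // ltW.
by lra.
Qed.

Lemma spectral_ball_conj M N N' : N *m N' = 1%:M -> spectral_ball R 3 M ->
  spectral_ball R 3 (N *m M *m N').
Proof.
move=> NN MO a /eigenvalueP[v vP v0]; apply: MO; apply/eigenvalueP.
have N'N : N' *m N = 1%:M by exact: mulmx1C.
exists (v *m N).
  by rewrite scalemxAl -vP -!mulmxA N'N mulmx1.
by apply: contra v0 => /eqP vN; rewrite -[v]mulmx1 -NN mulmxA vN mul0mx.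
Qed.

Lemma derivable_mulmx3 (f g : C -> M3) (z : C) :
  derivable f z 1 -> derivable g z 1 -> derivable (fun w => f w *m g w : M3) z 1.
Proof.
move=> /derivable_mxE df /derivable_mxE dg; apply/derivable_mxE => i j.
have -> : (fun w => (f w *m g w) i j : C) =
   (fun w => f w i 0 * g w 0 j + f w i 1 * g w 1 j + f w i 2 * g w 2 j : C).
  by apply/funext => w; rewrite mulmx3.
exact: (derivable_add (derivable_add (derivable_mul (df i 0) (dg 0 j))
  (derivable_mul (df i 1) (dg 1 j))) (derivable_mul (df i 2) (dg 2 j))).
Qed.

Lemma derivable_affine_mx M N (c z : C) : derivable (fun w : C => M + (c * w) *: N : M3) z 1.
Proof.
apply/derivable_mxE => i j.
have -> : (fun w : C => (M + (c * w) *: N) i j : C) = (fun w => M i j + (c * w) * N i j : C).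
  by apply/funext => w; rewrite !mxE.
exact: (derivable_add (@derivable_const R (M i j) z) (derivable_mul (derivable_mul
  (@derivable_const R c z) (@derivable_var R z)) (@derivable_const R (N i j) z))).
Qed.

(** Conjugate the disc by 1 + (w / alpha) N, which is invertible for every w,
    equals 1 at w = 0 and 1 + N at w = alpha. *)
Lemma reach_conj alpha M N : alpha != 0 -> N *m N = 0 -> reach alpha M ->
  reach alpha ((1%:M + N) *m M *m (1%:M - N)).
Proof.
move=> a0 NN [f [fh f0 fa]].
pose f' (w : C) : M3 := (1%:M + (alpha^-1 * w) *: N) *m f w *m (1%:M + (- alpha^-1 * w) *: N).
exists f'; split.
- move=> w w1; have [df fO] := fh w w1; split.
    apply: (@derivable_mulmx3 (fun w => (1%:M + (alpha^-1 * w) *: N) *m f w)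
      (fun w => 1%:M + (- alpha^-1 * w) *: N)).
      exact: (derivable_mulmx3 (@derivable_affine_mx 1%:M N alpha^-1 w) df).
    exact: derivable_affine_mx.
  apply: spectral_ball_conj => //.
  rewrite mulmxDr mulmx1 mulmxDl mul1mx -!scalemxAr -!scalemxAl NN !scaler0 addr0.
  by rewrite -addrA -scalerDl mulNr subrr scale0r addr0.
- by rewrite /f' !mulr0 !scale0r !addr0 mul1mx mulmx1.
- by rewrite /f' fa mulNr (mulVf a0) scaleNr !scale1r.
Qed.

Lemma reach_segment alpha M : alpha != 0 ->
  (forall z : R[i], normc z < (normc alpha)^-1 ->
     spectral_ball R 3 (matA R + z *: (M - matA R))) -> reach alpha M.
Proof.
move=> a0 H; exists (fun w : C => matA R + (alpha^-1 * w) *: (M - matA R)); split.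
- move=> w w1; split; first exact: derivable_affine_mx.
  apply: H; rewrite Normc.normcM Normc.normcV -[ltRHS]mulr1 ltr_pM2l //.
  by rewrite invr_gt0 normc_gt0.
- by rewrite mulr0 scale0r addr0.
- by rewrite mulVf // scale1r addrC subrK.
Qed.

(** The companion form M' differs from A in such a way that the pencil stays of
    the same shape, so its invariants are products of single entries; the factor
    (1 + z (u - 1)) / u comes from the entry (2,3), equal to 1 in A and to u in M'. *)
Lemma companion_pencil M x (z : R[i]) (u := krylov1 M x 1) : u != 0 -> krylov_det M x != 0 ->
  let N := matA R + z *: (companion M x - matA R) in
  [/\ \tr N = z * \tr M, sig2 N = z * sig2 M * ((1 + z * (u - 1)) / u)
    & \det N = z ^+ 2 * \det M * ((1 + z * (u - 1)) / u)].
Proof.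
move=> u0 D0 N; pose k := krylov_det M x / u.
have k0 : k != 0 by rewrite mulf_neq0 // invr_eq0.
have NE : N = mx3 0 (z * (k / u)) 0  0 (z * \tr M) (1 + z * (u - 1))
     (z * (\det M / k)) (z * (- sig2 M / u)) 0.
  apply/mx3P; do 2!apply: forall_ord3; rewrite !mxE /= -/u -/k; ring.
have detE (p q r s t : R[i]) : \det (mx3 0 p 0 0 q r s t 0) = p * r * s.
  by rewrite det3 !mxE /=; ring.
rewrite NE mxtrace3 detE /sig2 !mxE /=; split; first by ring.
  by move: (u^-1) => u'; ring.
clearbody k; move: (\det M) {NE D0} => d; clearbody u.
by field; rewrite u0 k0.
Qed.

(** By [companion_conj] it suffices to reach the companion form, along a segment.
    On the disc |z| < 1 / |alpha|, so |1 + z (u - 1)| <= 2, while |u| >= 1/2; hence the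
    extra factor of [companion_pencil] is at most 4, and 12 = 3 * 4. *)
Lemma reach_cyclic alpha M x (u := krylov1 M x 1) : alpha != 0 -> normc alpha <= 2^-1 ->
  normc (u - 1) <= normc alpha -> krylov_det M x != 0 ->
  12 * normc (\tr M) < normc alpha -> 12 * normc (sig2 M) < normc alpha ->
  12 * normc (\det M) < normc alpha ^+ 2 -> reach alpha M.
Proof.
move=> a0 a2 ua D0 h1 h2 h3.
have na : 0 < normc alpha by rewrite normc_gt0.
have u12 : 2^-1 <= normc u.
  have := le_normcD u (1 - u); rewrite addrC subrK Normc.normc1 [normc (1 - u)]normcB.
  by lra.
have u0 : u != 0 by rewrite -normc_gt0; lra.
have nu : 0 < normc u by rewrite normc_gt0.
have [N1 [N2 [N3 [sq1 sq2 sq3 ->]]]] := companion_conj u0 D0.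
do 3!apply: reach_conj => //; apply: reach_segment => // z zP.
have [e1 e2 e3] := companion_pencil z u0 D0.
have z0 := normc_ge0 z.
have za : normc z * normc alpha < 1 by rewrite -ltr_pdivlMr // div1r.
have ru : normc ((1 + z * (u - 1)) / u) <= 4.
  rewrite Normc.normcM Normc.normcV ler_pdivrMr //.
  apply: (@le_trans _ _ 2); last by lra.
  apply: le_trans (le_normcD _ _) _; rewrite Normc.normc1 Normc.normcM.
  by have := ler_wpM2l z0 ua; lra.
have small (c : R[i]) (p r : R) : 12 * normc c < r -> 0 <= p -> p * r <= 1 -> 
    p * normc c * 4 < 3^-1.
  move=> cr p0 pr.
  have [->|pn0] := eqVneq p 0; first by rewrite !mul0r invr_gt0.
  have p1 : 0 < p by rewrite lt_neqAle eq_sym pn0.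
  have h : p * (12 * normc c) < p * r by rewrite ltr_pM2l.
  by lra.
apply: spectral_ball_small.
- rewrite e1 Normc.normcM; have := small _ _ _ h1 z0 (ltW za).
  have : 0 <= normc z * normc (\tr M) by rewrite mulr_ge0 // normc_ge0.
  by lra.
- rewrite e2 (Normc.normcM (z * _)) (Normc.normcM z); apply: le_lt_trans (small _ _ _ h2 z0 (ltW
    za)).
  by rewrite ler_wpM2l // mulr_ge0 // normc_ge0.
- have z20 : 0 <= normc z ^+ 2 by rewrite exprn_ge0.
  have za2 : normc z ^+ 2 * normc alpha ^+ 2 <= 1.
    rewrite -exprMn; apply: exprn_ile1; last exact: ltW.
    by apply: mulr_ge0 => //; exact: ltW.
  rewrite e3 (Normc.normcM (z ^+ 2 * _)) (Normc.normcM (z ^+ 2)) normcX; apply: le_lt_trans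
      (small _ _ _ h3 z20 za2).
  by rewrite ler_wpM2l // mulr_ge0 // normc_ge0.
Qed.

End Reach.

(** * The pencil A + t C *)
Section CoefPencil.
Variable F : comNzRingType.
Implicit Types (M K : 'M[F]_3) (t x : F).

(** The coefficient of x in [krylov_det (A + t K) x] is t (t krylov_coef1 - K_32):
    the only contribution that is not divisible by t^2 comes from the entry (3,2)
    multiplied by the square of the entry (2,3), and the part of the latter beyond
    1 is divisible by t. *)
Definition krylov_coef1 t K : F :=
  let u := 1 + t * K 1 2 in
  let q10 := t * K 1 0 * K 0 0 + t * K 1 1 * K 1 0 + u * K 2 0 in
  let q02 := t * K 0 0 * K 0 2 + K 0 1 * u + t * K 0 2 * K 2 2 in
  let q12 := t * K 1 0 * K 0 2 + u * (K 1 1 + K 2 2) in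
  (K 0 0 * K 0 0 + K 0 1 * K 1 0 + K 0 2 * K 2 0) * u - q10 * K 0 2 + q02 * K 1 0
  - q12 * K 0 0 + q12 * K 2 2 - (K 2 0 * K 0 2 + K 2 2 * K 2 2) * u
  - K 2 1 * (K 1 2 + K 1 2 + t * K 1 2 * K 1 2).

End CoefPencil.

Section Pencil.
Variable R : realType.
Local Notation C := R[i]^o.
Local Notation M3 := ('M[R[i]]_3 : normedModType R[i]).
Implicit Types (t x : R[i]) (K : 'M[R[i]]_3).

Lemma pencilE t K i j : (matA R + t *: K) i j = ((i == 1) && (j == 2))%:R + t * K i j.
Proof. by rewrite !mxE. Qed.

Lemma pencil_tr t K : \tr (matA R + t *: K) = t * (K 0 0 + K 1 1 + K 2 2).
Proof. rewrite mxtrace3 !pencilE /=; ring. Qed.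

Lemma pencil_sig2 t K : sig2 (matA R + t *: K) = t * (t * sig2 K - K 2 1).
Proof. rewrite /sig2 !pencilE /=; ring. Qed.

Lemma pencil_det t K : \det (matA R + t *: K) =
  t ^+ 2 * (t * \det K - (K 0 0 * K 2 1 - K 0 1 * K 2 0)).
Proof. rewrite !det3 !pencilE /=; ring. Qed.

Lemma pencil_krylov1 t K x : krylov1 (matA R + t *: K) x 1 - 1 = t * (K 1 2 + x * K 1 0).
Proof. rewrite /krylov1 !pencilE /=; ring. Qed.

(** A cubic polynomial D has linear coefficient
    (18 D(1) - 11 D(0) - 9 D(2) + 2 D(3)) / 6, so that this coefficient is 0 if D
    vanishes at 0, 1, 2 and 3. *)
Lemma pencil_krylov_det t K : let D := krylov_det (matA R + t *: K) in
  18 * D 1 - 11 * D 0 - 9 * D 2 + 2 * D 3 = 6 * (t * (t * krylov_coef1 t K - K 2 1)).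
Proof. rewrite /= /krylov_coef1 /krylov_det /krylov2 /krylov1 !pencilE /=; ring. Qed.

Section Limits.
Variables (T : Type) (F : set_system T).
Context {FF : Filter F}.
Implicit Types (f g : T -> C).

Lemma cvg_fun_add f g (a b : C) : f @ F --> a -> g @ F --> b -> (fun i => f i + g i) @ F --> a + b.
Proof. move=> fa gb; exact: (cvgD fa gb). Qed.

Lemma cvg_fun_sub f g (a b : C) : f @ F --> a -> g @ F --> b -> (fun i => f i - g i) @ F --> a - b.
Proof. move=> fa gb; exact: (cvgB fa gb). Qed.

Lemma cvg_fun_mul f g (a b : C) : f @ F --> a -> g @ F --> b -> (fun i => f i * g i) @ F --> a * b.
Proof. move=> fa gb; exact: (cvgM fa gb). Qed.

Lemma cvg_fun_cst (a : C) : (fun _ : T => a) @ F --> a.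
Proof. exact: cvg_cst. Qed.

Variables (t : T -> C) (K : T -> 'M[R[i]]_3).
Hypothesis t0 : t @ F --> (0 : C).
Hypothesis KB : forall a b, (fun i => K i a b : C) @ F --> (matB R a b : C).

Lemma cvg_sig2 : (fun i => sig2 (K i) : C) @ F --> (sig2 (matB R) : C).
Proof.
have m a b c d := cvg_fun_mul (@KB a b) (@KB c d).
exact: cvg_fun_sub (cvg_fun_sub (cvg_fun_sub (cvg_fun_add (cvg_fun_add (m 0 0 1 1) (m 0 0 2 2))
    (m 1 1 2 2))
  (m 0 1 1 0)) (m 0 2 2 0)) (m 1 2 2 1).
Qed.

Lemma cvg_det3 : (fun i => \det (K i) : C) @ F --> (\det (matB R) : C).
Proof.
have m a b c d k l := cvg_fun_mul (cvg_fun_mul (@KB a b) (@KB c d)) (@KB k l).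
rewrite det3; under eq_fun do rewrite det3.
exact: cvg_fun_sub (cvg_fun_add (cvg_fun_add (cvg_fun_sub (cvg_fun_sub (m 0 0 1 1 2 2) (m 0 0 1 2
    2 1))
  (m 0 1 1 0 2 2)) (m 0 1 1 2 2 0)) (m 0 2 1 0 2 1)) (m 0 2 1 1 2 0).
Qed.

(** At t = 0 and K = B = diag(1, w, w^2) the value is
    1 - (w + w^2) + w w^2 = 3. *)
Lemma cvg_krylov_coef1 : (fun i => krylov_coef1 (t i) (K i) : C) @ F --> (3 : C).
Proof.
have u := cvg_fun_add (@cvg_fun_cst 1) (cvg_fun_mul t0 (@KB 1 2)).
have q10 := cvg_fun_add (cvg_fun_add (cvg_fun_mul (cvg_fun_mul t0 (@KB 1 0)) (@KB 0 0))
  (cvg_fun_mul (cvg_fun_mul t0 (@KB 1 1)) (@KB 1 0))) (cvg_fun_mul u (@KB 2 0)).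
have q02 := cvg_fun_add (cvg_fun_add (cvg_fun_mul (cvg_fun_mul t0 (@KB 0 0)) (@KB 0 2))
    (cvg_fun_mul (@KB 0 1) u))
  (cvg_fun_mul (cvg_fun_mul t0 (@KB 0 2)) (@KB 2 2)).
have q12 := cvg_fun_add (cvg_fun_mul (cvg_fun_mul t0 (@KB 1 0)) (@KB 0 2)) (cvg_fun_mul u
    (cvg_fun_add (@KB 1 1) (@KB 2 2))).
have m a b c d := cvg_fun_mul (@KB a b) (@KB c d).
have H := cvg_fun_sub (cvg_fun_sub (cvg_fun_add (cvg_fun_sub (cvg_fun_add (cvg_fun_sub
  (cvg_fun_mul (cvg_fun_add (cvg_fun_add (m 0 0 0 0) (m 0 1 1 0)) (m 0 2 2 0)) u) (cvg_fun_mul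
      q10 (@KB 0 2)))
  (cvg_fun_mul q02 (@KB 1 0))) (cvg_fun_mul q12 (@KB 0 0))) (cvg_fun_mul q12 (@KB 2 2)))
  (cvg_fun_mul (cvg_fun_add (m 2 0 0 2) (m 2 2 2 2)) u))
  (cvg_fun_mul (@KB 2 1) (cvg_fun_add (cvg_fun_add (@KB 1 2) (@KB 1 2)) (cvg_fun_mul (cvg_fun_mul
      t0 (@KB 1 2)) (@KB 1 2)))).
have w2 := omega_sum0 R; set om := omega R in w2.
have B00 := matB00 R.
have B11 : matB R 1 1 = om := matB11 R.
have B22 : matB R 2 2 = om ^+ 2 := matB22 R.
have B0 := matB_off R.
have -> : (3 : C) = krylov_coef1 0 (matB R) :> R[i]; last exact: H.
rewrite /krylov_coef1 B00 B11 B22 !B0 //.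
have {}w2 : om ^+ 2 = - 1 - om by apply/eqP; rewrite -subr_eq0 -w2; apply/eqP; ring.
ring: w2.
Qed.

Hypothesis tn0 : \forall i \near F, t i != 0.
Variable delta : R.
Hypothesis delta0 : 0 < delta.
Hypothesis K21 : \forall i \near F, delta <= normc (K i 2 1 / t i - 3).

(** The estimates required by [reach_cyclic] with alpha = e t: the quotients
    tr M / t, sig2 M / t, det M / t^2 and ((M v)_2 - 1) / t all tend to 0. *)
Lemma reach_pencil e : 0 < e ->
  \forall i \near F, reach (e%:C * t i) (matA R + t i *: K i).
Proof.
move=> e0.
have small f (r : R) : 0 < r -> f @ F --> (0 : C) -> \forall i \near F, normc (f i) < r.
  move=> r0 /cvg_complexP/(_ r r0); apply: filterS => i; by rewrite subr0.
have w2 := omega_sum0 R; set om := omega R in w2.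
have B00 := matB00 R.
have B11 : matB R 1 1 = om := matB11 R.
have B22 : matB R 2 2 = om ^+ 2 := matB22 R.
have B0 := matB_off R.
have z12 : (fun i => K i 1 2 : C) @ F --> (0 : C) by have := @KB 1 2; rewrite B0.
have z10 : (fun i => K i 1 0 : C) @ F --> (0 : C) by have := @KB 1 0; rewrite B0.
have ltr : (fun i => K i 0 0 + K i 1 1 + K i 2 2 : C) @ F --> (0 : C).
  by have := cvg_fun_add (cvg_fun_add (@KB 0 0) (@KB 1 1)) (@KB 2 2); rewrite B00 B11 B22 w2.
have lsig : (fun i => t i * sig2 (K i) - K i 2 1 : C) @ F --> (0 : C).
  have E : 0 * sig2 (matB R) - matB R 2 1 = 0 :> C by rewrite mul0r B0 // subr0.
  by rewrite -[X in _ --> X]E; exact: (cvg_fun_sub (cvg_fun_mul t0 cvg_sig2) (@KB 2 1)).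
have ldet : (fun i => t i * \det (K i) - (K i 0 0 * K i 2 1 - K i 0 1 * K i 2 0) : C) @ F --> (0
    : C).
  have E : 0 * \det (matB R) - (matB R 0 0 * matB R 2 1 - matB R 0 1 * matB R 2 0) = 0 :> C.
    by rewrite mul0r (B0 2 1) // (B0 0 1) // mulr0 mul0r !subr0.
  rewrite -[X in _ --> X]E.
  exact: (cvg_fun_sub (cvg_fun_mul t0 cvg_det3) (cvg_fun_sub (cvg_fun_mul (@KB 0 0) (@KB 2 1))
      (cvg_fun_mul (@KB 0 1) (@KB 2 0)))).
have e20 : 0 < e ^+ 2 / 12 by rewrite divr_gt0 // exprn_gt0.
near=> i.
have ti : t i != 0 by near: i.
have nt : 0 < normc (t i) by rewrite normc_gt0.
have na : normc (e%:C * t i) = e * normc (t i).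
  by rewrite Normc.normcM normc_real gtr0_norm.
(* If none of 0, 1, 2, 3 gave a cyclic vector, K_32 / t would equal
    krylov_coef1, which is close to 3. *)
have : exists2 x : R[i], normc x <= 3 & krylov_det (matA R + t i *: K i) x != 0.
  apply: contrapT => nex.
  have D0 (n : nat) : (n <= 3)%N -> krylov_det (matA R + t i *: K i) n%:R = 0.
    move=> n3; apply/eqP; apply: contrapT => /negP D; apply: nex; exists n%:R => //.
    by have := normc_real (n%:R : R); rewrite rmorph_nat normr_nat => ->; rewrite ler_nat.
  have := pencil_krylov_det (t i) (K i); rewrite /= (D0 0%N) // (D0 1%N) // (D0 2%N) // (D0 3%N) //.
  rewrite !mulr0 !subr0 addr0 => /esym/eqP; rewrite !mulf_eq0 (negbTE ti) pnatr_eq0 /=.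
  rewrite subr_eq0 => /eqP E.
  have d1 : normc (krylov_coef1 (t i) (K i) - 3) < delta.
    by near: i; move/cvg_complexP: cvg_krylov_coef1; apply.
  have d2 : delta <= normc (K i 2 1 / t i - 3) by near: i.
  by move: d2; rewrite -E mulrC mulKf // leNgt d1.
move=> [x x3 Dx].
have n12 : normc (K i 1 2) < e / 4 by near: i; apply: small => //; rewrite divr_gt0.
have n10 : normc (K i 1 0) < e / 4 by near: i; apply: small => //; rewrite divr_gt0.
apply: (@reach_cyclic R _ _ x) => //.
- by rewrite mulf_neq0 // -normc_gt0 normc_real normr_gt0 gt_eqF.
- rewrite na mulrC -ler_pdivlMr //; apply/ltW; near: i; apply: small => //.
  by rewrite divr_gt0 // invr_gt0.
- rewrite pencil_krylov1 Normc.normcM na mulrC ler_pM2r //.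
  apply: le_trans (le_normcD _ _) _; rewrite Normc.normcM.
  have : normc x * normc (K i 1 0) <= 3 * normc (K i 1 0) by rewrite ler_wpM2r ?normc_ge0.
  by lra.
- rewrite pencil_tr Normc.normcM na mulrCA [ltRHS]mulrC ltr_pM2l // mulrC -ltr_pdivlMr //.
  by near: i; apply: small => //; rewrite divr_gt0.
- rewrite pencil_sig2 Normc.normcM na mulrCA [ltRHS]mulrC ltr_pM2l // mulrC -ltr_pdivlMr //.
  by near: i; apply: small => //; rewrite divr_gt0.
- rewrite pencil_det Normc.normcM normcX na exprMn mulrCA [ltRHS]mulrC ltr_pM2l ?exprn_gt0 //.
  rewrite mulrC -ltr_pdivlMr //.
  by near: i; apply: small.
Unshelve. all: by end_near. Qed.

Lemma lempert_pencil e : 0 < e -> \forall i \near F,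
  (lempert (spectral_ball R 3 : set M3) (matA R) (matA R + t i *: K i)%R <= (e * normc (t i))%:E)%E.
Proof.
move=> e0; near=> i.
have ti : normc (t i) < e^-1.
  near: i; move/cvg_complexP: t0 => /(_ e^-1); rewrite invr_gt0 => /(_ e0).
  by apply: filterS => i; rewrite subr0.
have na : normc (e%:C * t i) = e * normc (t i).
  by rewrite Normc.normcM normc_real gtr0_norm.
rewrite -na; apply: ereal_inf_lbound; exists (e%:C * t i) => //; split.
  have : normc (e%:C * t i) < 1 by rewrite na mulrC -ltr_pdivlMr // div1r.
  by [].
by near: i; exact: reach_pencil.
Unshelve. all: by end_near. Qed.

End Limits.
End Pencil.

(** * Extended real limits *)
Section Ereal.
Variable R : realType.
Local Notation C := R[i]^o.

Lemma lempert_ge0 (V : normedModType R[i]) (D : set V) z w : (0 <= lempert D z w)%E.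
Proof. by apply: le_ereal_inf_tmp => _ [a _ <-]; rewrite lee_fin normc_ge0. Qed.

Lemma cvge0_squeeze (T : Type) (F : set_system T) {FF : Filter F} (u : T -> \bar R) :
  (forall i, (0 <= u i)%E) -> (forall e : R, 0 < e -> \forall i \near F, (u i <= e%:E)%E) ->
  u @ F --> 0%E.
Proof.
move=> u0 ue P P0; have /nbhs_ballP[e /= e0 eP] : nbhs (0 : R) (fun r => P r%:E) := P0.
have e20 : 0 < e / 2 by rewrite divr_gt0.
apply: filterS (ue _ e20) => i ui; rewrite /=; move: ui (u0 i).
case: (u i) => [r| |] //; rewrite !lee_fin => re r0.
by apply: eP; rewrite /ball /= sub0r normrN ger0_norm //; lra.
Qed.

Lemma limn_einf_gt0 (u : nat -> R) : (0 < limn_einf (fun j => (u j)%:E))%E ->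
  exists2 d : R, 0 < d & \forall j \near \oo, d <= u j.
Proof.
rewrite /limn_einf oppe_gt0 => /ereal_inf_lt[_ [V Voo <-] supV].
have [d d0 dV] : exists2 d : R, 0 < d & (ereal_sup [set (\- (fun j => (u j)%:E))%E x | x in V] <=
    (- d)%:E)%E.
  case: (ereal_sup _) supV => [r| |] //.
    by rewrite lte_fin => r0; exists (- r); rewrite ?oppr_gt0 // opprK.
  by move=> _; exists 1 => //; rewrite leNye.
exists d => //; apply: filterS Voo => j Vj.
have : ((- u j)%:E <= (- d)%:E)%E.
  by apply: le_trans dV; apply: ereal_sup_ubound; exists j.
by rewrite lee_fin lerN2.
Qed.

End Ereal.

Theorem proposition10p1 (R : realType) :
  let Omega3 := spectral_ball R 3 in
  let A := matA R in
  let B := matB R in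
  [/\ (0 < kobayashi Omega3 A B)%E,
      limf_esup (fun t : R[i]^o =>
        (lempert Omega3 A (A + t *: B)%R * ((normc t)^-1)%:E)%E) (dnbhs 0)
        = 0%E
    & forall (t : nat -> R[i]^o) (C : nat -> 'M[R[i]]_3),
        (forall j, t j != 0) ->
        t @ \oo --> (0 : R[i]^o) ->
        C @ \oo --> (B : ('M[R[i]]_3 : normedModType R[i])) ->
        (0 < limn_einf (fun j => (normc (C j 2 1 / t j - 3))%:E))%E ->
        (fun j => (lempert Omega3 A (A + t j *: C j)%R
                     * ((normc (t j))^-1)%:E)%E) @ \oo --> 0%E ].
Proof.
move=> Omega3 A B.
have quot0 (t : R[i]^o) (K : 'M[R[i]]_3) :
    (0 <= lempert Omega3 A (A + t *: K)%R * ((normc t)^-1)%:E)%E.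
  by rewrite mule_ge0 ?lempert_ge0 // lee_fin invr_ge0 normc_ge0.
have quot_le (t : R[i]^o) (K : 'M[R[i]]_3) e : t != 0 ->
    (lempert Omega3 A (A + t *: K)%R <= (e * normc t)%:E)%E ->
    (lempert Omega3 A (A + t *: K)%R * ((normc t)^-1)%:E <= e%:E)%E.
  move=> t0 le; have nt : 0 < normc t by rewrite normc_gt0.
  apply: (@le_trans _ _ ((e * normc t)%:E * ((normc t)^-1)%:E)%E).
    by apply: lee_wpmul2r => //; rewrite lee_fin invr_ge0 ltW.
  by rewrite -EFinM mulfK // gt_eqF.
split.
- exact: kobayashi_gt0.
- apply/eqP; rewrite eq_le; apply/andP; split; last first.
    apply: le_ereal_inf_tmp => _ [V V0 <-].
    have [t Vt] : V !=set0.
      move: V0; rewrite /dnbhs /within => /nbhs_complexP[d d0 dV].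
      have nd : normc ((d / 2)%:C : R[i]) = d / 2 by rewrite normc_real gtr0_norm // divr_gt0.
      exists (d / 2)%:C; apply: dV; first by rewrite subr0 nd; lra.
      by rewrite -normc_gt0 nd divr_gt0.
    apply: le_trans (quot0 t B) _; apply: ereal_sup_ubound; by exists t.
  apply/lee_addgt0Pr => e e0; rewrite add0e.
  have idt : (fun t : R[i]^o => t) @ dnbhs (0 : R[i]^o) --> (0 : R[i]^o).
    exact: nbhs_dnbhs.
  have tn0 : \forall t \near dnbhs (0 : R[i]^o), t != 0 by exact: nbhs_dnbhs_neq.
  have KB a b : (fun _ : R[i]^o => B a b : R[i]^o) @ dnbhs (0 : R[i]^o) --> (B a b : R[i]^o).
    exact: cvg_cst.
  have K21 : \forall t \near dnbhs (0 : R[i]^o), (3 : R) <= normc (B 2 1 / t - 3).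
    near=> t; have -> : B 2 1 = 0 by rewrite !mxE.
    rewrite mul0r sub0r normcN.
    by have := normc_real (3 : R); rewrite rmorph_nat normr_nat => ->.
  have H := @lempert_pencil R _ _ (dnbhs_filter (0 : R[i]^o)) (fun t : R[i]^o => t) (fun=> B) idt
      KB tn0 3 (ltr0n _ 3) K21 e e0.
  apply: ge_ereal_inf; exists (ereal_sup [set (lempert Omega3 A (A + t *: B)%R * ((normc
      t)^-1)%:E)%E
    | t in [set t : R[i]^o | t != 0 /\
       (lempert Omega3 A (A + t *: B)%R <= (e * normc t)%:E)%E]]).
    exists [set t : R[i]^o | t != 0 /\
      (lempert Omega3 A (A + t *: B)%R <= (e * normc t)%:E)%E] => //.
    exact: (filterI tn0 H).
  by apply: ge_ereal_sup => _ [t [t0 tP] <-]; exact: quot_le.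
- move=> t K t0 tc KB /limn_einf_gt0[d d0 K21].
  have KB' a b : (fun i => K i a b : R[i]^o) @ \oo --> (B a b : R[i]^o).
    by have /cvg_mxP KB' := KB; exact: KB'.
  have tn0 : \forall i \near \oo, t i != 0 by near=> i.
  apply: cvge0_squeeze => [i|e e0]; first exact: quot0.
  have H := @lempert_pencil R _ _ eventually_filter t K tc KB' tn0 d d0 K21 e e0.
  by apply: filterS H => i; exact: quot_le.
Unshelve. all: by end_near. Qed.
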